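(* Let $T:E\to F$ be an almost order-weakly compact operator between two Banach lattices $E$ and $F$. If at least one of the following conditions holds, then the adjoint $T':F'\to E'$ is almost order-weakly compact: (1) $E$ has an order unit; (2) $E'$ is a $KB$-space and $F'$ has an order unit.
   Context: $E'$ denotes the norm dual of $E$. Let $E$ be a Banach lattice with closed unit ball $B_E$. A subset $A\subseteq E$ is almost order bounded if for every $\epsilon>0$ there exists $u\in E^+$ such that $A\subseteq [-u,u]+\epsilon B_E$. A continuous (linear) operator $T:E\to F$ between Banach lattices is almost order-weakly compact if it maps every almost order bounded subset of $E$ onto a relatively weakly compact subset of $F$. A vector $e>0$ in a vector lattice $E$ is an order unit if the ideal generated by $e$ equals $E$, i.e. for every $x\ge 0$ there is $n\in\mathbb{N}$ with $x\le ne$. A Banach lattice $E$ is a $KB$-space if every increasing norm bounded sequence of $E^+$ is norm convergent. *)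

(* Defs.v *)
From HB Require Import structures.
From mathcomp Require Import all_boot all_order all_algebra.
From mathcomp Require Import all_classical all_reals topology normedtype sequences.

Set Implicit Arguments.
Unset Strict Implicit.
Unset Printing Implicit Defensive.

Import Order.TTheory GRing.Theory Num.Theory.
Import numFieldNormedType.Exports.

Local Open Scope classical_set_scope.
Local Open Scope ring_scope.

Reserved Notation "x <=v y" (at level 70, y at next level).

(* The order is not an instance of [Order.Lattice]: in the hierarchy the join of
   lattices with additive groups is already [Num.RealDomain], and that of partial
   orders with normed additive groups is a structure of numeric rings, so a
   normed module cannot also be declared to be an ordered type. *)
HB.mixin Record isVectorLattice (R : numDomainType) (E : Type)
    & GRing.Lmodule R E := {
  vle : rel E ;
  vsup : E -> E -> E ;
  vinf : E -> E -> E ;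
  vle_refl : reflexive vle ;
  vle_anti : antisymmetric vle ;
  vle_trans : transitive vle ;
  vsup_le : forall x y z, vle (vsup x y) z = vle x z && vle y z ;
  vle_inf : forall x y z, vle z (vinf x y) = vle z x && vle z y ;
  vle_add2r : forall z x y, vle x y -> vle (x + z) (y + z) ;
  vle_scale : forall (a : R) x y, 0 <= a -> vle x y -> vle (a *: x) (a *: y)
}.

#[short(type="vectorLatticeType")]
HB.structure Definition VectorLattice (R : numDomainType) :=
  {E of GRing.Lmodule R E & isVectorLattice R E}.

Notation "x <=v y" := (vle x y) : ring_scope.

Arguments vle_trans {R s} [y x z].
Arguments vle_add2r {R s} z [x y].
Arguments vle_scale {R s} [a x y].

Definition vabs (R : numDomainType) (E : vectorLatticeType R) (x : E) : E :=
  vsup x (- x).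

HB.mixin Record VectorLattice_isBanachLattice (R : realType) (E : Type)
    & CompleteNormedModule R E & VectorLattice R E := {
  le_norm_vabs : forall x y : E, vabs x <=v vabs y -> `|x| <= `|y|
}.

#[short(type="banachLatticeType")]
HB.structure Definition BanachLattice (R : realType) :=
  {E of CompleteNormedModule R E & VectorLattice R E
      & VectorLattice_isBanachLattice R E}.

HB.structure Definition LinearContinuous (R : numDomainType)
    (E F : normedModType R) :=
  {f of @Continuous E F f & @GRing.Linear R E F *:%R f}.

Notation "{ 'linear_continuous' E -> F }" :=
  (@LinearContinuous.type _ E F) (E at level 98, F at level 99,
  format "{ 'linear_continuous'  E  ->  F }") : type_scope.

Section VectorLatticeTheory.
Context (R : realFieldType) (E : vectorLatticeType R).
Implicit Types x y z u v : E.

Lemma vle_supl x y : x <=v vsup x y.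
Proof. by have := vsup_le x y (vsup x y); rewrite vle_refl => /esym/andP[]. Qed.

Lemma vle_supr x y : y <=v vsup x y.
Proof. by have := vsup_le x y (vsup x y); rewrite vle_refl => /esym/andP[]. Qed.

Lemma vle_infl x y : vinf x y <=v x.
Proof. by have := vle_inf x y (vinf x y); rewrite vle_refl => /esym/andP[]. Qed.

Lemma vle_infr x y : vinf x y <=v y.
Proof. by have := vle_inf x y (vinf x y); rewrite vle_refl => /esym/andP[]. Qed.

Lemma vle_addl z x y : x <=v y -> z + x <=v z + y.
Proof. by move=> xy; rewrite ![z + _]addrC; exact: vle_add2r. Qed.

Lemma vle_add x y z u : x <=v y -> z <=v u -> x + z <=v y + u.
Proof. by move=> /(vle_add2r z) h /(vle_addl y); exact: vle_trans. Qed.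

Lemma vle_add0 x y : 0 <=v x -> 0 <=v y -> 0 <=v x + y.
Proof. by move=> hx hy; have := vle_add hx hy; rewrite addr0. Qed.

Lemma vle_subr_ge0 x y : (0 <=v y - x) = (x <=v y).
Proof.
apply/idP/idP => [/(vle_add2r x)|/(vle_add2r (- x))].
  by rewrite add0r subrK.
by rewrite subrr.
Qed.

Lemma vle_opp x y : x <=v y -> - y <=v - x.
Proof.
by rewrite -(vle_subr_ge0 x) -(vle_subr_ge0 (- y)) opprK addrC.
Qed.

Lemma vle_scale0 (a : R) x : 0 <= a -> 0 <=v x -> 0 <=v a *: x.
Proof. by move=> a0 /(vle_scale a0); rewrite scaler0. Qed.

Lemma vle_abs x : x <=v vabs x. Proof. exact: vle_supl. Qed.

Lemma vabs_ge0 x : 0 <=v vabs x.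
Proof.
have h : 0 <=v vabs x + vabs x.
  by rewrite -(subrr x); apply: vle_add; [exact: vle_supl|exact: vle_supr].
have -> : vabs x = 2^-1 *: (vabs x + vabs x).
  by rewrite -mulr2n -(scaler_nat 2 (vabs x)) scalerA mulVf ?scale1r// pnatr_eq0.
by apply: vle_scale0 => //; rewrite invr_ge0 ler0n.
Qed.

Lemma ge0_vabs x : 0 <=v x -> vabs x = x.
Proof.
move=> x0; apply: vle_anti; rewrite vle_supl andbT vsup_le vle_refl/=.
by apply: (vle_trans _ x0); have := vle_opp x0; rewrite oppr0.
Qed.

Definition vpos x := vsup x 0.
Definition vneg x := vpos x - x.

Lemma vpos_ge0 x : 0 <=v vpos x. Proof. exact: vle_supr. Qed.

Lemma vneg_ge0 x : 0 <=v vneg x. Proof. by rewrite vle_subr_ge0 vle_supl. Qed.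

Lemma vposBneg x : vpos x - vneg x = x.
Proof. by rewrite /vneg subKr. Qed.

Lemma vpos_le_abs x : vpos x <=v vabs x.
Proof. by rewrite vsup_le vle_abs vabs_ge0. Qed.

Lemma vle_subl_add x y z : (x - y <=v z) = (x <=v z + y).
Proof. by rewrite -vle_subr_ge0 opprB addrA vle_subr_ge0. Qed.

Lemma vneg_le_abs x : vneg x <=v vabs x.
Proof.
rewrite /vneg vle_subl_add vsup_le; apply/andP; split.
  by have := vle_add2r x (vabs_ge0 x); rewrite add0r.
by have := vle_add2r x (vle_supr x (- x)); rewrite addNr.
Qed.

Lemma riesz_decomposition x y z : 0 <=v x -> 0 <=v y -> 0 <=v z ->
  z <=v x + y -> exists z1 z2, [/\ z = z1 + z2, 0 <=v z1, z1 <=v x,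
    0 <=v z2 & z2 <=v y].
Proof.
move=> x0 y0 z0 zxy; exists (vinf z x), (z - vinf z x); split.
- by rewrite subrKC.
- by rewrite vle_inf z0 x0.
- exact: vle_infr.
- by rewrite vle_subr_ge0 vle_infl.
- rewrite vle_subl_add addrC -vle_subl_add vle_inf !vle_subl_add zxy andbT.
  by have := vle_addl z y0; rewrite addr0.
Qed.

Section cone_extension.
Context (F : lmodType R) (p : E -> F).
Hypothesis pD : forall x y, 0 <=v x -> 0 <=v y -> p (x + y) = p x + p y.
Hypothesis pZ : forall (a : R) x, 0 <= a -> 0 <=v x -> p (a *: x) = a *: p x.

Definition cone_ext x : F := p (vpos x) - p (vneg x).

Lemma cone_extB u v : 0 <=v u -> 0 <=v v -> cone_ext (u - v) = p u - p v.
Proof.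
move=> u0 v0; apply/eqP; rewrite /cone_ext subr_eq addrAC eq_sym subr_eq.
rewrite -(pD u0 (vneg_ge0 _)) -(pD (vpos_ge0 _) v0); apply/eqP; congr p.
by rewrite /vneg opprB addrCA subrKC.
Qed.

Lemma cone_ext_ge0 x : 0 <=v x -> cone_ext x = p x.
Proof.
move=> x0; rewrite -[x in LHS]subr0 cone_extB ?vle_refl//.
by have := pZ (lexx 0) (vle_refl 0); rewrite !scale0r => ->; rewrite subr0.
Qed.

Lemma cone_ext_linear : linear cone_ext.
Proof.
have D x y : cone_ext (x + y) = cone_ext x + cone_ext y.
  rewrite -{1}(vposBneg x) -{1}(vposBneg y) addrACA -opprD.
  rewrite (cone_extB (vle_add0 (vpos_ge0 x) (vpos_ge0 y))
    (vle_add0 (vneg_ge0 x) (vneg_ge0 y))).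
  by rewrite (pD (vpos_ge0 x) (vpos_ge0 y)) (pD (vneg_ge0 x) (vneg_ge0 y)) opprD
    addrACA.
move=> a x y; rewrite D; congr (_ + _).
rewrite -{1}(vposBneg x); have [a0|a0] := leP 0 a.
  rewrite scalerBr (cone_extB (vle_scale0 a0 (vpos_ge0 x))
    (vle_scale0 a0 (vneg_ge0 x))).
  by rewrite !pZ ?vpos_ge0 ?vneg_ge0// -scalerBr.
have Na0 : 0 <= - a by rewrite oppr_ge0 ltW.
rewrite -[a]opprK scaleNr -scalerN opprB scalerBr.
rewrite (cone_extB (vle_scale0 Na0 (vneg_ge0 x)) (vle_scale0 Na0 (vpos_ge0 x))).
rewrite !pZ ?vpos_ge0 ?vneg_ge0//.
by rewrite -scalerBr [RHS]scaleNr -scalerN opprB.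
Qed.

End cone_extension.

End VectorLatticeTheory.

Section LinearContinuousTheory.
Context (R : realType) (E F : normedModType R).
Implicit Types f g : {linear_continuous E -> F}.

Lemma linear_continuous_eqP f g : f =1 g -> f = g.
Proof.
case: f g => [f [[fc] [fa] [fs]]] [g [[gc] [ga] [gs]]] /= /funext fg.
case: _ / fg gc ga gs => gc ga gs; congr LinearContinuous.Pack.
rewrite (Prop_irrelevance fc gc) (Prop_irrelevance fs gs).
by rewrite (Prop_irrelevance fa ga).
Qed.

Lemma linear_continuous_bound f : exists M, forall x, `|f x| <= M * `|x|.
Proof.
have /linear_boundedP := continuous_linear_bounded 0 (@cts_fun _ _ f 0).
by move=> /pinfty_ex_gt0[M _ h]; exists M.
Qed.

Definition mk_linear_continuous (f : E -> F) (lf : linear f)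
    (cf : continuous f) : {linear_continuous E -> F} :=
  HB.pack f (isContinuous.Build E F f cf)
    (GRing.isLinear.Build R E F *:%R f lf).

Lemma linear_bound_continuous (f : E -> F) (M : R) : linear f ->
  (forall x, `|f x| <= M * `|x|) -> continuous f.
Proof.
move=> lf fM; pose g : {linear E -> F} :=
  HB.pack f (GRing.isLinear.Build R E F *:%R f lf).
apply: (@bounded_linear_continuous _ _ _ g); apply: (linear_boundedP g).2.
near=> r => x; rewrite (le_trans (fM x))// ler_wpM2r//.
by near: r; apply: nbhs_pinfty_ge; exact: num_real.
Unshelve. all: by end_near. Qed.

End LinearContinuousTheory.

Definition dual (R : realType) (E : normedModType R) : Type :=
  {linear_continuous E -> R^o}.

Section DualSpace.
Context (R : realType) (E : normedModType R).
Implicit Types (f g h : dual E) (x y : E).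

HB.instance Definition _ := gen_eqMixin (dual E).
HB.instance Definition _ := gen_choiceMixin (dual E).

Let dual_of (f : E -> R^o) (M : R) (lf : linear f)
    (fM : forall x, `|f x| <= M * `|x|) : dual E :=
  mk_linear_continuous lf (linear_bound_continuous lf fM).

Fact dual_zero_linear : linear (cst 0 : E -> R^o).
Proof. by move=> a x y; rewrite /cst scaler0 addr0. Qed.

Fact dual_zero_cts : continuous (cst 0 : E -> R^o).
Proof. exact: cst_continuous. Qed.

Fact dual_opp_linear f : linear (fun x => - f x : R^o).
Proof. by move=> a x y; rewrite linearP opprD scalerN. Qed.

Fact dual_opp_cts f : continuous (fun x => - f x : R^o).
Proof. by move=> x; exact: (cvgN (@cts_fun _ _ f x)). Qed.

Fact dual_add_linear f g : linear (fun x => f x + g x : R^o).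
Proof. by move=> a x y; rewrite !linearP scalerDr addrACA. Qed.

Fact dual_add_cts f g : continuous (fun x => f x + g x : R^o).
Proof. by move=> x; exact: (cvgD (@cts_fun _ _ f x) (@cts_fun _ _ g x)). Qed.

Fact dual_scale_linear (a : R) f : linear (fun x => a *: f x : R^o).
Proof.
by move=> b x y; rewrite linearP scalerDr !scalerA [a * b]mulrC.
Qed.

Fact dual_scale_cts (a : R) f : continuous (fun x => a *: f x : R^o).
Proof. by move=> x; exact: (cvgZ (cvg_cst a) (@cts_fun _ _ f x)). Qed.

Definition dual_zero : dual E :=
  mk_linear_continuous dual_zero_linear dual_zero_cts.
Definition dual_opp f : dual E :=
  mk_linear_continuous (dual_opp_linear f) (@dual_opp_cts f).
Definition dual_add f g : dual E :=
  mk_linear_continuous (dual_add_linear f g) (@dual_add_cts f g).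
Definition dual_scale (a : R) f : dual E :=
  mk_linear_continuous (dual_scale_linear a f) (@dual_scale_cts a f).

Fact dual_addA : associative dual_add.
Proof. by move=> f g h; apply: linear_continuous_eqP => x; exact: addrA. Qed.

Fact dual_addC : commutative dual_add.
Proof. by move=> f g; apply: linear_continuous_eqP => x; exact: addrC. Qed.

Fact dual_add0 : left_id dual_zero dual_add.
Proof. by move=> f; apply: linear_continuous_eqP => x; exact: add0r. Qed.

Fact dual_addN : left_inverse dual_zero dual_opp dual_add.
Proof. by move=> f; apply: linear_continuous_eqP => x; exact: addNr. Qed.

HB.instance Definition _ :=
  GRing.isZmodule.Build (dual E) dual_addA dual_addC dual_add0 dual_addN.

Fact dual_scaleA (a b : R) f :
  dual_scale a (dual_scale b f) = dual_scale (a * b) f.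
Proof. by apply: linear_continuous_eqP => x; exact: scalerA. Qed.

Fact dual_scale1 : left_id 1 dual_scale.
Proof. by move=> f; apply: linear_continuous_eqP => x; exact: scale1r. Qed.

Fact dual_scaleDr : right_distributive dual_scale +%R.
Proof. by move=> a f g; apply: linear_continuous_eqP => x; exact: scalerDr. Qed.

Fact dual_scaleDl f : {morph dual_scale^~ f : a b / a + b}.
Proof. by move=> a b; apply: linear_continuous_eqP => x; exact: scalerDl. Qed.

HB.instance Definition _ := GRing.Zmodule_isLmodule.Build R (dual E)
  dual_scaleA dual_scale1 dual_scaleDr dual_scaleDl.

Lemma dual0E x : (0 : dual E) x = 0. Proof. by []. Qed.
Lemma dualNE f x : (- f) x = - f x. Proof. by []. Qed.
Lemma dualDE f g x : (f + g) x = f x + g x. Proof. by []. Qed.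
Lemma dualBE f g x : (f - g) x = f x - g x. Proof. by []. Qed.
Lemma dualZE (a : R) f x : (a *: f) x = a * f x. Proof. by []. Qed.

Definition dual_norm f : R := sup [set `|f x| | x in [set x | `|x| <= 1]].

Let has_sup_dual_norm f : has_sup [set `|f x| | x in [set x | `|x| <= 1]].
Proof.
split; first by exists `|f 0|, 0 => //=; rewrite normr0.
have [M fM] := linear_continuous_bound f.
exists `|M| => _ [x /= x1 <-]; rewrite (le_trans (fM x))//.
rewrite (le_trans (ler_wpM2r _ (ler_norm M)))//.
by rewrite -[leRHS]mulr1 ler_wpM2l.
Qed.

Lemma dual_norm_ge0 f : 0 <= dual_norm f.
Proof.
apply: (le_trans (normr_ge0 (f 0))).
by apply: (sup_upper_bound (has_sup_dual_norm f)); exists 0; rewrite //= normr0.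
Qed.

Lemma dual_norm_le f (M : R) : 0 <= M ->
  (forall x, `|f x| <= M * `|x|) -> dual_norm f <= M.
Proof.
move=> M0 fM; apply: ge_sup; first by case: (has_sup_dual_norm f).
move=> _ [x /= x1 <-]; rewrite (le_trans (fM x))//.
by rewrite -[leRHS]mulr1 ler_wpM2l.
Qed.

Lemma le_dual_norm f x : `|f x| <= dual_norm f * `|x|.
Proof.
have [->|x0] := eqVneq x 0; first by rewrite linear0 !normr0 mulr0.
have nx0 : 0 < `|x| by rewrite normr_gt0.
rewrite -ler_pdivrMr//.
apply: (sup_upper_bound (has_sup_dual_norm f)).
exists (`|x|^-1 *: x) => /=.
  by rewrite normrZ gtr0_norm ?invr_gt0// mulVf// gt_eqF.
by rewrite linearZ/= normrM gtr0_norm ?invr_gt0// mulrC.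
Qed.

Fact dual_ler_normD f g : dual_norm (f + g) <= dual_norm f + dual_norm g.
Proof.
apply: dual_norm_le; first by rewrite addr_ge0 ?dual_norm_ge0.
move=> x; rewrite dualDE (le_trans (ler_normD _ _))// mulrDl.
by rewrite lerD ?le_dual_norm.
Qed.

Fact dual_normrZ (a : R) f : dual_norm (a *: f) = `|a| * dual_norm f.
Proof.
have le b g : dual_norm (b *: g) <= `|b| * dual_norm g.
  apply: dual_norm_le; first by rewrite mulr_ge0 ?dual_norm_ge0.
  by move=> x; rewrite dualZE normrM -mulrA ler_wpM2l ?le_dual_norm.
apply/eqP; rewrite eq_le le/=.
have [->|a0] := eqVneq a 0; first by rewrite normr0 mul0r dual_norm_ge0.
have /(ler_wpM2l (normr_ge0 a)) := le a^-1 (a *: f).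
by rewrite scalerA mulVf// scale1r mulrA normfV mulfV ?mul1r ?normr_eq0.
Qed.

Fact dual_normr0_eq0 f : dual_norm f = 0 -> f = 0.
Proof.
move=> f0; apply: linear_continuous_eqP => x; apply/eqP; rewrite -normr_le0.
by have := le_dual_norm f x; rewrite f0 mul0r.
Qed.

HB.instance Definition _ := Lmodule_isNormed.Build R (dual E)
  dual_ler_normD dual_normrZ dual_normr0_eq0.

Lemma dual_normE f : `|f| = sup [set `|f x| | x in [set x | `|x| <= 1]].
Proof. by []. Qed.

Lemma ler_dual_norm f x : `|f x| <= `|f| * `|x|.
Proof. exact: le_dual_norm. Qed.

Lemma dual_norm_bound f (M : R) : 0 <= M ->
  (forall x, `|f x| <= M * `|x|) -> `|f| <= M.
Proof. exact: dual_norm_le. Qed.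

Fact dual_complete (F : set_system (dual E)) :
  ProperFilter F -> cauchy F -> cvg F.
Proof.
move=> FF /cauchy_ballP cF.
have F_filter : Filter F by exact: filter_filter.
have cvx x : cvg ((fun f => f x : R^o) @ F).
  apply: cauchy_cvg; apply/cauchy_ballP => e e0 /=.
  have d0 : 0 < e / (`|x| + 1) by rewrite divr_gt0// ltr_wpDl.
  rewrite near_map2; apply: (filterS _ (cF _ d0)) => -[f g] /=.
  rewrite -!ball_normE/= => fg; rewrite -dualBE (le_lt_trans (ler_dual_norm _ _))//.
  rewrite (@le_lt_trans _ _ (`|f - g| * (`|x| + 1)))//.
    by rewrite ler_wpM2l// lerDl.
  by rewrite -ltr_pdivlMr// ltr_wpDl.
pose L x : R^o := lim ((fun f => f x : R^o) @ F).
have Llin : linear L.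
  move=> a x y; rewrite /L; apply: cvg_lim => //.
  under eq_fun do rewrite linearP.
  exact: (cvgD (cvgZ (cvg_cst a) (cvx x)) (cvx y)).
have Lnear (e : R) : 0 < e ->
    F [set f : dual E | forall x, `|L x - f x| <= e * `|x|].
  move=> e0; have H : \forall f \near F, \forall g \near F, ball f e g.
    by apply: nearP_dep; exact: cF.
  apply: filterS H => f Ff x.
  apply/ler_addgt0Pl => d d0.
  have Fd : \forall g \near F, `|L x - (g : dual E) x| <= d.
    by have /cvgrPdist_le/(_ _ d0) := cvx x.
  have [g [fg Lg]] := filter_ex (filterI Ff Fd).
  rewrite -[L x](subrK (g x)) -addrA (le_trans (ler_normD _ _))// lerD//.
  rewrite -dualBE (le_trans (ler_dual_norm _ _))// ler_wpM2r// distrC ltW//.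
have [f0 f0L] := filter_ex (Lnear _ ltr01).
have LM x : `|L x| <= (1 + `|f0|) * `|x|.
  rewrite -[L x](subrK (f0 x)) (le_trans (ler_normD _ _))// mulrDl mul1r.
  by rewrite lerD ?ler_dual_norm// (le_trans (f0L x))// mul1r.
apply/cvg_ex; exists (dual_of Llin LM : dual E).
apply/cvgrPdist_le => e e0; apply: filterS (Lnear _ e0) => f fe.
by apply: dual_norm_bound => [|x]; [exact: ltW|exact: fe].
Qed.

HB.instance Definition _ := Uniform_isComplete.Build (dual E) dual_complete.

End DualSpace.

Section DualLattice.
Context (R : realType) (E : banachLatticeType R).
Implicit Types (f g h : dual E) (x y z : E).

Definition dual_le f g := `[< forall x, 0 <=v x -> f x <= g x >].

Fact dual_le_refl : reflexive dual_le.
Proof. by move=> f; apply/asboolP => x _. Qed.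

Fact dual_le_anti : antisymmetric dual_le.
Proof.
move=> f g /andP[/asboolP fg /asboolP gf]; apply: linear_continuous_eqP => x.
have eq0 y : 0 <=v y -> f y = g y.
  by move=> y0; apply/eqP; rewrite eq_le fg// gf.
rewrite -(vposBneg x) linearB [RHS]linearB /=.
by rewrite (eq0 _ (vpos_ge0 x)) (eq0 _ (vneg_ge0 x)).
Qed.

Fact dual_le_trans : transitive dual_le.
Proof.
move=> g f h /asboolP fg /asboolP gh; apply/asboolP => x x0.
exact: le_trans (fg x x0) (gh x x0).
Qed.

Fact dual_le_add2r h f g : dual_le f g -> dual_le (f + h) (g + h).
Proof. by move=> /asboolP fg; apply/asboolP => x x0; rewrite lerD2r fg. Qed.

Fact dual_le_scale (a : R) f g : 0 <= a -> dual_le f g ->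
  dual_le (a *: f) (a *: g).
Proof.
by move=> a0 /asboolP fg; apply/asboolP => x x0; rewrite ler_wpM2l// fg.
Qed.

Fact dual_subr_ge0 f g : dual_le 0 (g - f) = dual_le f g.
Proof.
by apply/asboolP/asboolP => h x /h; rewrite dualBE subr_ge0.
Qed.

(* Riesz-Kantorovich: at x >= 0, the positive part of f is the supremum of f
   over the order interval [0, x]. *)
Let pos_set f x := [set f y | y in [set y | 0 <=v y /\ y <=v x]].
Let pos_cone f x : R := sup (pos_set f x).

Let le_norm_pos x y : 0 <=v x -> x <=v y -> `|x| <= `|y|.
Proof.
by move=> x0 xy; apply: le_norm_vabs; rewrite !ge0_vabs//; exact: vle_trans xy.
Qed.

Let has_sup_pos f x : 0 <=v x -> has_sup (pos_set f x).
Proof.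
move=> x0; split; first by exists (f 0), 0; rewrite //= vle_refl x0.
exists (`|f| * `|x|) => _ [y [y0 yx] <-].
rewrite (le_trans (ler_norm _))// (le_trans (ler_dual_norm _ _))//.
by rewrite ler_wpM2l// le_norm_pos.
Qed.

Let pos_cone_ub f x y : 0 <=v y -> y <=v x -> f y <= pos_cone f x.
Proof.
move=> y0 yx; apply: (sup_upper_bound (has_sup_pos f (vle_trans y0 yx))).
by exists y.
Qed.

Let pos_cone_le f x (M : R) : 0 <=v x ->
  (forall y, 0 <=v y -> y <=v x -> f y <= M) -> pos_cone f x <= M.
Proof.
move=> x0 fM; apply: ge_sup; first by case: (has_sup_pos f x0).
by move=> _ [y [y0 yx] <-]; exact: fM.
Qed.

Let pos_coneD f x y : 0 <=v x -> 0 <=v y ->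
  pos_cone f (x + y) = pos_cone f x + pos_cone f y.
Proof.
move=> x0 y0; apply/eqP; rewrite eq_le; apply/andP; split.
  apply: pos_cone_le; first exact: vle_add0.
  move=> z z0 /(riesz_decomposition x0 y0 z0)[u [v [-> u0 ux v0 vy]]].
  by rewrite linearD lerD// pos_cone_ub.
rewrite -lerBrDr; apply: pos_cone_le => // u u0 ux.
rewrite lerBrDr -lerBrDl; apply: pos_cone_le => // v v0 vy.
by rewrite lerBrDl -linearD pos_cone_ub ?vle_add0// vle_add.
Qed.

Let pos_coneZ f (a : R) x : 0 <= a -> 0 <=v x ->
  pos_cone f (a *: x) = a *: (pos_cone f x : R^o).
Proof.
have le b z : 0 < b -> 0 <=v z -> b * pos_cone f z <= pos_cone f (b *: z).
  move=> b0 z0; rewrite mulrC -ler_pdivlMr//; apply: pos_cone_le => // y y0 yz.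
  rewrite ler_pdivlMr// mulrC -[b * f y]/(b *: (f y : R^o)) -linearZ.
  by rewrite pos_cone_ub ?vle_scale0 ?(ltW b0)// vle_scale// ltW.
rewrite le_eqVlt => /predU1P[<- x0|a0 x0].
  rewrite !scale0r; apply/eqP; rewrite eq_le; apply/andP; split.
    apply: pos_cone_le => [|y y0 yx]; first exact: vle_refl.
    have -> : y = 0 by apply: vle_anti; rewrite yx y0.
    by rewrite linear0.
  by rewrite -[leLHS](linear0 f) pos_cone_ub ?vle_refl.
apply/eqP; rewrite eq_le le// andbT.
have ai0 : 0 < a^-1 by rewrite invr_gt0.
have /(ler_wpM2l (ltW a0)) := le _ _ ai0 (vle_scale0 (ltW a0) x0).
by rewrite scalerA mulVf ?gt_eqF// scale1r mulrA mulfV ?gt_eqF// mul1r.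
Qed.

Let pos_fun f : E -> R^o := cone_ext (pos_cone f : E -> R^o).

Let pos_fun_linear f : linear (pos_fun f).
Proof. exact: (cone_ext_linear (pos_coneD f) (@pos_coneZ f)). Qed.

Let pos_funE f x : 0 <=v x -> pos_fun f x = pos_cone f x.
Proof. exact: (cone_ext_ge0 (pos_coneD f) (@pos_coneZ f)). Qed.

Let norm_vabs x : `|vabs x| = `|x|.
Proof.
have h := ge0_vabs (vabs_ge0 x).
by apply/eqP; rewrite eq_le !le_norm_vabs ?h ?vle_refl.
Qed.

Let pos_fun_bound f x : `|pos_fun f x| <= `|f| *+ 2 * `|x|.
Proof.
have B y : 0 <=v y -> y <=v vabs x -> `|pos_cone f y| <= `|f| * `|x|.
  move=> y0 yx; rewrite ger0_norm; last first.
    by rewrite -[leLHS](linear0 f) pos_cone_ub ?vle_refl.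
  apply: pos_cone_le => // z z0 zy.
  rewrite (le_trans (ler_norm _))// (le_trans (ler_dual_norm _ _))//.
  by rewrite ler_wpM2l// -(norm_vabs x) le_norm_pos// (vle_trans zy).
rewrite (le_trans (ler_normB _ _))// mulrnAl mulr2n lerD// B//.
- exact: vpos_ge0.
- exact: vpos_le_abs.
- exact: vneg_ge0.
- exact: vneg_le_abs.
Qed.

Definition dual_pos f : dual E := mk_linear_continuous (pos_fun_linear f)
  (linear_bound_continuous (pos_fun_linear f) (pos_fun_bound f)).

Lemma dual_posE f x : 0 <=v x ->
  dual_pos f x = sup [set f y | y in [set y | 0 <=v y /\ y <=v x]].
Proof. exact: pos_funE. Qed.

Let dual_pos_le f g :
  dual_le (dual_pos f) g = dual_le f g && dual_le 0 g.
Proof.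
apply/asboolP/andP => [fg|[/asboolP fg /asboolP g0] x x0].
  by split; apply/asboolP => x x0; apply: le_trans (fg x x0);
    rewrite dual_posE// -/(pos_set _ _) -/(pos_cone _ _) ?dual0E;
    rewrite -?[leLHS](linear0 f) pos_cone_ub ?vle_refl.
rewrite dual_posE//; apply: pos_cone_le => // y y0 yx.
rewrite (le_trans (fg _ y0))// -subr_ge0 -linearB.
by rewrite g0// vle_subr_ge0.
Qed.

Definition dual_sup f g : dual E := f + dual_pos (g - f).
Definition dual_inf f g : dual E := - dual_sup (- f) (- g).

Fact dual_sup_le f g h : dual_le (dual_sup f g) h = dual_le f h && dual_le g h.
Proof.
rewrite -dual_subr_ge0 /dual_sup opprD addrA dual_subr_ge0 dual_pos_le andbC.
rewrite dual_subr_ge0; congr (_ && _).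
by rewrite -dual_subr_ge0 opprB addrA subrK dual_subr_ge0.
Qed.

Fact dual_le_inf f g h : dual_le h (dual_inf f g) = dual_le h f && dual_le h g.
Proof.
have N u v : dual_le u (- v) = dual_le v (- u).
  by rewrite -dual_subr_ge0 -[RHS]dual_subr_ge0 addrC.
by rewrite /dual_inf N dual_sup_le !(N _ h) !opprK.
Qed.

HB.instance Definition _ := isVectorLattice.Build R (dual E)
  dual_le_refl dual_le_anti dual_le_trans dual_sup_le dual_le_inf
  dual_le_add2r dual_le_scale.

Lemma dual_vleP f g : reflect (forall x, 0 <=v x -> f x <= g x) (f <=v g).
Proof. exact: asboolP. Qed.

Let le_vabs f x : `|f x| <= vabs f (vabs x).
Proof.
have hp y : 0 <=v y -> `|f y| <= vabs f y.
  move=> y0; rewrite ler_norml; apply/andP; split.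
    by rewrite lerNl; have /dual_vleP/(_ _ y0) := vle_supr f (- f).
  by have /dual_vleP/(_ _ y0) := vle_supl f (- f).
have p0 : 0 <=v vabs x + x.
  by have := vle_add2r x (vle_supr x (- x)); rewrite addNr.
have m0 : 0 <=v vabs x - x by rewrite vle_subr_ge0 vle_supl.
have x2 : (vabs x + x) - (vabs x - x) = 2%:R *: x.
  by rewrite opprB addrC addrA subrK scaler_nat mulr2n.
have a2 : (vabs x + x) + (vabs x - x) = 2%:R *: vabs x.
  by rewrite addrACA subrr addr0 scaler_nat mulr2n.
have fx2 : f (vabs x + x) - f (vabs x - x) = 2%:R * f x.
  by rewrite -linearB x2 linearZ.
have fa2 : vabs f (vabs x + x) + vabs f (vabs x - x) = 2%:R * vabs f (vabs x).
  by rewrite -linearD a2 linearZ.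
rewrite -(ler_pM2l (ltr0Sn R 1)) -fa2 -[X in X * `|_|]ger0_norm// -normrM -fx2.
by rewrite (le_trans (ler_normB _ _))// (lerD (hp _ p0) (hp _ m0)).
Qed.

Let vabs_le_norm g y : 0 <=v y -> vabs g y <= `|g| * `|y|.
Proof.
move=> y0; rewrite -[vabs g]/(g + dual_pos (- g - g)) dualDE -lerBrDl.
rewrite dual_posE//; apply: pos_cone_le => // z z0 zy.
rewrite lerBrDl dualBE dualNE.
have -> : g y + (- g z - g z) = g (y - (z + z)).
  by rewrite linearB linearD opprD.
rewrite (le_trans (ler_norm _))// (le_trans (ler_dual_norm _ _))//.
rewrite ler_wpM2l// le_norm_vabs// [vabs y]ge0_vabs// vsup_le.
rewrite opprB vle_subl_add vle_subl_add; apply/andP; split.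
  by have := vle_addl y (vle_add0 z0 z0); rewrite addr0.
exact: vle_add.
Qed.

Fact dual_le_norm_vabs f g : vabs f <=v vabs g -> `|f| <= `|g|.
Proof.
move=> /dual_vleP fg; apply: dual_norm_bound => // x.
apply: (le_trans (le_vabs f x)); apply: (le_trans (fg _ (vabs_ge0 x))).
by rewrite -(norm_vabs x) vabs_le_norm// vabs_ge0.
Qed.

HB.instance Definition _ :=
  VectorLattice_isBanachLattice.Build R (dual E) dual_le_norm_vabs.

End DualLattice.

Section Adjoint.
Context (R : realType) (E F : normedModType R).
Variable T : {linear_continuous E -> F}.

Fact adjoint_fun_linear (f : dual F) : linear (fun x => f (T x) : R^o).
Proof. by move=> a x y; rewrite linearP /= linearP. Qed.

Fact adjoint_fun_cts (f : dual F) : continuous (fun x => f (T x) : R^o).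
Proof.
move=> x; apply: (@continuous_comp _ _ _ T f).
  exact: (@cts_fun _ _ T x).
exact: (@cts_fun _ _ f (T x)).
Qed.

Definition adjoint_fun (f : dual F) : dual E :=
  mk_linear_continuous (adjoint_fun_linear f) (@adjoint_fun_cts f).

Fact adjoint_linear : linear adjoint_fun.
Proof. by move=> a f g; apply: linear_continuous_eqP. Qed.

Fact adjoint_cts : continuous adjoint_fun.
Proof.
have [M TM] := linear_continuous_bound T.
apply: (linear_bound_continuous (M := `|M|) adjoint_linear) => f.
apply: dual_norm_bound => [|x]; first by rewrite mulr_ge0.
rewrite (le_trans (ler_dual_norm f (T x)))// -mulrA mulrCA ler_wpM2l//.
by rewrite (le_trans (TM x))// ler_wpM2r// ler_norm.
Qed.

Definition adjoint : {linear_continuous dual F -> dual E} :=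
  mk_linear_continuous adjoint_linear adjoint_cts.

Lemma adjointE (f : dual F) (x : E) : adjoint f x = f (T x).
Proof. by []. Qed.

End Adjoint.

(* The coarsest topology on E that makes every f in the dual continuous, obtained
   from the pointwise topology along x |-> (f |-> f x). *)
Definition weak_eval (R : realType) (E : normedModType R) (x : E) :
  {ptws dual E -> R^o} := fun f => f x.

Definition weak (R : realType) (E : normedModType R) : Type :=
  initial_topology (@weak_eval R E).

HB.instance Definition _ (R : realType) (E : normedModType R) :=
  Uniform.copy (weak E) (initial_topology (@weak_eval R E)).

Lemma weak_cvgP (R : realType) (E : normedModType R) (G : set_system (weak E))
    (x : weak E) : Filter G ->
  G --> x <-> forall f : dual E, (fun y : E => f y : R^o) @ G --> (f x : R^o).
Proof.
move=> GG; split=> [Gx f|Gx].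
  apply: (cvg_trans (cvg_app (fun y : weak E => f y : R^o) Gx)).
  apply: (@continuous_comp (weak E) {ptws dual E -> R^o} R^o
    (@weak_eval R E) (fun g => g f) x).
    exact: initial_continuous.
  exact: (@proj_continuous _ (fun=> R^o) f).
have /pointwise_cvgP : forall f : dual E, (fun g => g f) @
    (@weak_eval R E @ G : set_system (dual E -> R^o)) --> (weak_eval x f : R^o).
  exact: Gx.
move=> Gev A [_ [[B oB <-] Bx] /filterS]; apply.
by apply: Gev; exact: open_nbhs_nbhs.
Qed.

(* [precompact A] unfolds to the compactness of the closure of [A], here for the
   weak topology (lemma [precompactE]). *)
Definition relatively_weakly_compact (R : realType) (E : normedModType R)
  (A : set E) := precompact (A : set (weak E)).

Definition order_unit (R : numDomainType) (E : vectorLatticeType R) (e : E) :=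
  [/\ 0 <=v e, e <> 0 & forall x, 0 <=v x -> exists n : nat, x <=v e *+ n].

Section BanachLatticeNotions.
Context (R : realType).
Implicit Types E F : banachLatticeType R.

Definition order_interval E (a b : E) := [set x | a <=v x /\ x <=v b].

(* The inclusion is A `<=` [-u, u] + eps B_E, with B_E the closed unit ball. *)
Definition almost_order_bounded E (A : set E) := forall eps : R, 0 < eps ->
  exists2 u : E, 0 <=v u &
    A `<=` [set x + eps *: b | x in order_interval (- u) u
                             & b in [set b | `|b| <= 1]].

Definition almost_order_weakly_compact E F (T : {linear_continuous E -> F}) :=
  forall A : set E, almost_order_bounded A ->
    relatively_weakly_compact (T @` A).

Definition KB_space E := forall u : nat -> E,
  (forall n, 0 <=v u n) ->
  {homo u : m n / (m <= n)%N >-> m <=v n} ->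
  (exists M : R, forall n, `|u n| <= M) ->
  cvg (u @ \oo).

End BanachLatticeNotions.

(* Main.v *)
Require Import Defs.
From mathcomp Require Import all_boot all_order all_algebra.
From mathcomp Require Import all_classical all_reals topology normedtype sequences.
From mathcomp Require Import ring lra.

Set Implicit Arguments.
Unset Strict Implicit.
Unset Printing Implicit Defensive.

Import Order.TTheory GRing.Theory Num.Theory.
Import numFieldNormedType.Exports.

Local Open Scope classical_set_scope.
Local Open Scope ring_scope.

(** Write [T''] for the second adjoint of [T]. The theorem reduces to one fact:
    for every [phi] in [E''] the functional [T'' phi : g |-> phi (T' g)] on [F']
    is evaluation at a vector of [F]. Indeed, an ultrafilter on a bounded subset
    of [F'] converges pointwise to some [l] in [F'] (Alaoglu), and if all the
    functionals [phi o T'] are evaluations then its image under [T'] converges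
    weakly to [T' l]. So [T'] maps all bounded sets, in particular all almost
    order bounded ones, to relatively weakly compact sets
    ([bidual_represented_rel_compact]).

    If [phi] is dominated by a vector [u] of [E], that is
    [phi f <= vabs f u] for all [f], then [T'' phi] is an evaluation: [vabs f u]
    is the supremum of [f] over [[-u, u]], hence [T'' phi g] is at most the
    supremum of [g] over the convex, relatively weakly compact set
    [T [-u, u]], and a finite dimensional separation argument puts [T'' phi] in
    the weak closure of that set ([order_bounded_represented]). When [E] has an
    order unit, every [phi] is dominated by a multiple of it, which settles the
    first case.

    In the second case let [phi >= 0]. Each [phi /\ u], with [u >= 0] in [E], is
    dominated by [u], so [T'' (phi /\ u)] is evaluation at some [y_u].
    Two facts finish the proof.

    - The functionals [phi /\ u] increase pointwise to [phi]
      ([KB_vinf_eval_approx]). Monotone bounded sequences of [E'] converge in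
      norm, and this is what excludes a part of [phi] disjoint from all of [E].
    - The net [y_u] is Cauchy in norm ([vinf_eval_cauchy]). Otherwise there is
      an increasing sequence [u_n] for which [z_n = y_(u_(n+1)) - y_(u_n)] has
      norm bounded below. All signed sums of the [z_n] are bounded in terms of
      [phi]. But [F'] has an order unit [e], so the norm of [F] is equivalent to
      [e (vabs x)], which is additive on the cone as in an [L1] space, and there
      a Khinchine inequality makes the average of the signed sums of [n] such
      vectors grow like the square root of [n] ([unconditional_small]).

    Khinchine's inequality is needed for vectors of a vector lattice, without a
    functional calculus. It is obtained from a linear lower bound
    [sin s x <= vabs x] at the end of every path of signs, where [s] is an angle
    turned at every step by [r] or [- r] according to the sign: the sums over
    paths are computed by the addition formulas ([sum_signs_ge]). *)

(** * Vector lattices and Banach lattices *)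

Section VectorLattice.
Context (R : realType) (E : vectorLatticeType R).
Implicit Types x y u : E.

Lemma vabs_le x u : (vabs x <=v u) = (x <=v u) && (- x <=v u).
Proof. exact: vsup_le. Qed.

Lemma vle_absN x : - x <=v vabs x. Proof. exact: vle_supr. Qed.

Lemma vabsN x : vabs (- x) = vabs x.
Proof. apply: vle_anti; rewrite !vabs_le opprK vle_abs vle_absN /=.
by rewrite -{1}[x]opprK vle_absN vle_abs. Qed.

Lemma vle_sub x y z u : x <=v y -> z <=v u -> x - u <=v y - z.
Proof. by move=> xy zu; exact: vle_add (vle_opp zu). Qed.

Lemma vle_oppC x y : (- x <=v y) = (- y <=v x).
Proof. by rewrite -vle_subr_ge0 -[RHS]vle_subr_ge0 !opprK addrC. Qed.

Lemma vle_scaleW (a b : R) x : a <= b -> 0 <=v x -> a *: x <=v b *: x.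
Proof.
by move=> ab x0; rewrite -vle_subr_ge0 -scalerBl vle_scale0// subr_ge0.
Qed.

End VectorLattice.

Section BanachLattice.
Context (R : realType) (E : banachLatticeType R).
Implicit Types x y u : E.

Lemma order_intervalP x u : order_interval (- u) u x <-> vabs x <=v u.
Proof.
rewrite vabs_le [(- x <=v u)]vle_oppC /order_interval /=.
by split => [[-> ->]|/andP[-> ->]].
Qed.

Lemma norm_vabs x : `|vabs x| = `|x|.
Proof.
have h := ge0_vabs (vabs_ge0 x).
by apply/eqP; rewrite eq_le !le_norm_vabs ?h ?vle_refl.
Qed.

Lemma le_norm_of_vabs x y : vabs x <=v y -> `|x| <= `|y|.
Proof.
by move=> xy; rewrite le_norm_vabs// (vle_trans xy)// vle_abs.
Qed.

Lemma le_norm_ge0 x y : 0 <=v x -> x <=v y -> `|x| <= `|y|.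
Proof. by move=> x0 xy; rewrite le_norm_of_vabs// ge0_vabs. Qed.

Lemma vneg_le_sub x y : 0 <=v x -> vneg y <=v vabs (x - y).
Proof.
move=> x0; rewrite /vneg vle_subl_add vsup_le; apply/andP; split.
  by have := vle_add2r y (vabs_ge0 (x - y)); rewrite add0r.
by apply: (vle_trans x0); rewrite -vle_subl_add vle_abs.
Qed.

Lemma positive_cone_closed (x : nat -> E) y :
  (forall n, 0 <=v x n) -> x @ \oo --> y -> 0 <=v y.
Proof.
move=> x0 xy; suff : `|vneg y| <= 0.
  by rewrite normr_le0 => /eqP n0; rewrite -(vposBneg y) n0 subr0 vpos_ge0.
apply/ler_addgt0Pl => e e0; rewrite addr0.
have [n xye] : exists n, `|y - x n| <= e.
  by have /cvgrPdist_le/(_ _ e0)/filter_ex := xy.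
apply: le_trans xye; rewrite [leRHS]distrC -[leRHS]norm_vabs.
by apply: le_norm_ge0; [exact: vneg_ge0|exact: vneg_le_sub].
Qed.

(** If the bound fails for every constant, there are positive [x n] of norm at
    most [2^-n] with [x n] not below [n e]; their sum dominates each of them and
    lies below some [m e]. *)
Lemma order_unit_bound (e : E) : order_unit e ->
  exists2 C : R, 0 <= C & forall x, vabs x <=v (C * `|x|) *: e.
Proof.
move=> [e0 _ eu]; apply: contrapT => /forall2NP noC.
have bad (n : nat) : exists x : E, [/\ 0 <=v x, `|x| <= 2^-1 ^+ n.+1 &
    ~ x <=v e *+ n].
  have [|] := noC (2 ^+ n.+1 * n%:R); first by rewrite mulr_ge0// exprn_ge0.
  move=> /existsNP[x xC]; have x0 : `|x| != 0.
    apply/eqP => x0; apply: xC.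
    suff -> : vabs x = 0 by rewrite x0 mulr0 scale0r vle_refl.
    by apply/eqP; rewrite -normr_eq0 norm_vabs x0.
  pose a : R := 2^-1 ^+ n.+1 / `|x|.
  have a0 : 0 < a.
    by rewrite divr_gt0 ?exprn_gt0 ?invr_gt0// normr_gt0 -normr_eq0.
  exists (a *: vabs x); split.
  - by rewrite vle_scale0 ?vabs_ge0// ltW.
  - by rewrite normrZ norm_vabs gtr0_norm// /a mulfVK.
  have ai0 : 0 <= a^-1 by rewrite invr_ge0 ltW.
  move=> /(vle_scale ai0); rewrite scalerA mulVf ?gt_eqF// scale1r => xe.
  apply: xC; apply: (vle_trans xe); rewrite -scaler_nat scalerA /a invf_div.
  have -> : `|x| / 2^-1 ^+ n.+1 * n%:R = 2 ^+ n.+1 * n%:R * `|x|.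
    by rewrite exprVn invrK -mulrA mulrC.
  exact: vle_refl.
have [x x0 /all_and2[xn nxe]] : exists2 x : nat -> E, (forall n, 0 <=v x n) &
    forall n, `|x n| <= 2^-1 ^+ n.+1 /\ ~ x n <=v e *+ n.
  have [x xP] := choice bad; exists x => n; first by have [] := xP n.
  by have [] := xP n.
have cx : cvgn (series x).
  apply: normed_cvg; apply: (@series_le_cvg _ _ (geometric 2^-1 2^-1)) => //.
  - by move=> n; rewrite /= normr_ge0.
  - by move=> n; rewrite /= -exprS exprn_ge0// invr_ge0.
  - by move=> n; rewrite /geometric/= -exprS xn.
  - apply: is_cvg_geometric_series.
    by rewrite gtr0_norm ?invr_gt0// invf_lt1// ltr1n.
have part0 n : 0 <=v series x n.
  elim: n => [|n IHn]; first by rewrite /series/= big_geq ?vle_refl.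
  by rewrite seriesSr vle_add0.
have part_le n m : x n <=v series x (m + n.+1)%N.
  elim: m => [|m IHm]; first by rewrite add0n seriesSr -vle_subl_add subrr.
  by rewrite addSn seriesSr -[x n]addr0 vle_add.
have le_s n : x n <=v limn (series x).
  rewrite -vle_subr_ge0; pose v m := series x (m + n.+1)%N - x n.
  apply: (@positive_cone_closed v) => [m|]; first by rewrite vle_subr_ge0.
  by apply: cvgB; [rewrite (cvg_shiftn n.+1) | exact: cvg_cst].
have s0 : 0 <=v limn (series x) by exact: vle_trans (x0 0%N) (le_s 0%N).
have [m sm] := eu _ s0.
by apply: (nxe m); exact: vle_trans (le_s m) sm.
Qed.

End BanachLattice.

(** * Norming functionals *)

Section HahnBanach.
Context (R : realType) (V : normedModType R).
Implicit Types (p q : V -> R) (x y z : V).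

Definition sublinear q := (forall x y, q (x + y) <= q x + q y) /\
  (forall (a : R) x, 0 < a -> q (a *: x) <= a * q x).

Lemma sublinear0 q : sublinear q -> q 0 = 0.
Proof.
move=> [qD qZ]; have := qD 0 0; have : q (2^-1 *: 0) <= 2^-1 * q 0.
  by apply: qZ; rewrite invr_gt0.
by rewrite scaler0 addr0; lra.
Qed.

Lemma sublinearZ q (a : R) x : sublinear q -> 0 <= a -> q (a *: x) = a * q x.
Proof.
move=> sq; rewrite le_eqVlt => /predU1P[<-|a0].
  by rewrite scale0r mul0r sublinear0.
apply/eqP; rewrite eq_le sq.2//=.
have /sq.2 h : 0 < a^-1 by rewrite invr_gt0.
have := h (a *: x); rewrite scalerA mulVf ?gt_eqF// scale1r.
by rewrite -ler_pdivlMl.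
Qed.

Lemma sublinear_geN q x : sublinear q -> - q (- x) <= q x.
Proof.
by move=> sq; have := sq.1 x (- x); rewrite subrr sublinear0//; lra.
Qed.

(** A sublinear minorant of [q] with [straighten q y (- y) <= - q y]. A minimal
    [q] therefore equals it for every [y], which is additivity. *)
Definition straighten q y x : R :=
  inf [set q (x + t *: y) - t * q y | t in [set t | 0 <= t]].

Section Straighten.
Variables (q : V -> R) (y : V).
Hypothesis sq : sublinear q.

Let straighten_has_inf x :
  has_inf [set q (x + t *: y) - t * q y | t in [set t | 0 <= t]].
Proof.
split; first by exists (q (x + 0 *: y) - 0 * q y), 0 => //=.
exists (- q (- x)) => _ [t /= t0 <-].
by have := sq.1 (- x) (x + t *: y); rewrite addKr sublinearZ//; lra.
Qed.

Lemma straighten_le x t : 0 <= t ->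
  straighten q y x <= q (x + t *: y) - t * q y.
Proof. by move=> t0; apply: (ge_inf (straighten_has_inf x).2); exists t. Qed.

Lemma le_straighten x c : (forall t, 0 <= t -> c <= q (x + t *: y) - t * q y) ->
  c <= straighten q y x.
Proof.
move=> cq; apply: lb_le_inf; first by case: (straighten_has_inf x).
by move=> _ [t /= t0 <-]; exact: cq.
Qed.

Lemma straighten_le_id x : straighten q y x <= q x.
Proof.
by have := straighten_le x (lexx 0); rewrite scale0r addr0 mul0r subr0.
Qed.

Lemma straighten_sublinear : sublinear (straighten q y).
Proof.
split=> [x x'|a x a0].
  rewrite -lerBlDr; apply: le_straighten => t t0.
  rewrite lerBlDr [leRHS]addrC -lerBlDr.
  apply: le_straighten => t' t'0; rewrite lerBlDr.
  have := straighten_le (x + x') (addr_ge0 t0 t'0); rewrite scalerDl addrACA.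
  by have := sq.1 (x + t *: y) (x' + t' *: y); lra.
rewrite mulrC -ler_pdivrMr//; apply: le_straighten => t t0.
rewrite ler_pdivrMr//.
have := straighten_le (a *: x) (mulr_ge0 (ltW a0) t0).
rewrite -scalerA -scalerDr [q _](sublinearZ _ sq (ltW a0)).
by lra.
Qed.

End Straighten.

(** Zorn's lemma: the pointwise infimum of a chain is sublinear, and is finite
    because [- p (- x) <= q x] for every sublinear [q] below [p]. *)
Lemma minimal_sublinear p : sublinear p -> exists q, [/\ sublinear q,
  forall x, q x <= p x & forall q', sublinear q' -> (forall x, q' x <= q x) ->
  forall x, q x <= q' x].
Proof.
move=> sp; pose S := {q : V -> R | sublinear q /\ forall x, q x <= p x}.
pose le (s t : S) : bool := `[< forall x, sval t x <= sval s x >].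
pose sp0 : S := exist _ p (conj sp (fun=> lexx _)).
have [||A Atot|q qmin] := @ZL_preorder S sp0 le.
- by move=> s; apply/asboolP => x.
- move=> r s t /asboolP rs /asboolP st; apply/asboolP => x.
  exact: le_trans (st x) (rs x).
- have [[s0 As0]|A0] := pselect (exists s, A s); last first.
    by exists sp0 => s As; case: A0; exists s.
  pose m x : R := inf [set sval s x | s in A].
  have hm x : has_inf [set sval s x | s in A].
    split; first by exists (sval s0 x), s0.
    exists (- p (- x)) => _ [s As <-].
    apply: le_trans (sublinear_geN x (svalP s).1).
    by rewrite lerN2 (svalP s).2.
  have m_le s x : A s -> m x <= sval s x.
    by move=> As; apply: (ge_inf (hm x).2); exists s.
  have le_m x c : (forall s, A s -> c <= sval s x) -> c <= m x.
    move=> cs; apply: lb_le_inf; first by case: (hm x).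
    by move=> _ [s As <-]; exact: cs.
  have sm : sublinear m.
    split=> [x y|a x a0].
      rewrite -lerBlDr; apply: (le_m) => s As.
      rewrite lerBlDr [leRHS]addrC -lerBlDr.
      apply: le_m => t At; rewrite lerBlDr.
      have [/asboolP st|/asboolP ts] := Atot _ _ As At.
        have := m_le _ (x + y) At; have := (svalP t).1.1 x y.
        by have := st x; lra.
      have := m_le _ (x + y) As; have := (svalP s).1.1 x y.
      by have := ts y; lra.
    rewrite mulrC -ler_pdivrMr//; apply: le_m => s As; rewrite ler_pdivrMr//.
    by rewrite mulrC (le_trans (m_le _ _ As))// (svalP s).1.2.
  have mp x : m x <= p x by rewrite (le_trans (m_le _ x As0))// (svalP s0).2.
  by exists (exist _ m (conj sm mp)) => s As; apply/asboolP => x; exact: m_le.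
exists (sval q); split=> [|x|q' sq' q'q x];
  [exact: (svalP q).1|exact: (svalP q).2|].
have q'p y : q' y <= p y by rewrite (le_trans (q'q y))// (svalP q).2.
have /asboolP : le (exist _ q' (conj sq' q'p)) q.
  by apply: qmin; apply/asboolP.
exact.
Qed.

Lemma minimal_sublinear_linear q : sublinear q ->
  (forall q', sublinear q' -> (forall x, q' x <= q x) ->
    forall x, q x <= q' x) ->
  linear (q : V -> R^o).
Proof.
move=> sq qmin; have qD x y : q (x + y) = q x + q y.
  apply/eqP; rewrite eq_le sq.1/=.
  have := qmin _ (straighten_sublinear y sq) (straighten_le_id y sq) x.
  by have := straighten_le y sq x ler01; rewrite scale1r mul1r; lra.
have qN x : q (- x) = - q x.
  by apply/eqP; rewrite -addr_eq0 -qD addNr sublinear0.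
move=> a x y; rewrite qD; congr (_ + _).
have [a0|a0] := leP 0 a; first exact: sublinearZ.
by rewrite -[a]opprK scaleNr qN sublinearZ ?oppr_ge0 1?ltW// [RHS]mulNr.
Qed.

(** A minimal sublinear functional below the norm straightened along [z] is
    linear and takes a value at most [- `|z|] at [- z]. *)
Lemma norming_functional z : exists2 g : dual V, `|g| <= 1 & g z = `|z|.
Proof.
have sn : sublinear (fun x => `|x|).
  split=> [x y|a x a0]; first exact: ler_normD.
  by rewrite normrZ gtr0_norm.
have [q [sq qp qmin]] := minimal_sublinear (straighten_sublinear z sn).
have lq := minimal_sublinear_linear sq qmin.
have qn x : q x <= `|x| by exact: le_trans (qp x) (straighten_le_id z sn x).
have qN x : q (- x) = - q x.
  have := lq (-1) x 0; rewrite !scaleN1r !addr0 => ->.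
  by rewrite sublinear0// addr0.
have qb x : `|q x : R^o| <= 1 * `|x|.
  by rewrite mul1r ler_norml qn lerNl -qN -[X in _ <= X]normrN qn.
exists (mk_linear_continuous lq (linear_bound_continuous lq qb)).
  exact: dual_norm_bound.
apply/eqP; rewrite eq_le qn/= -lerN2 -qN.
rewrite (le_trans (qp _))// (le_trans (straighten_le z sn (- z) ler01))//.
by rewrite scale1r addNr normr0 mul1r sub0r.
Qed.

End HahnBanach.

(** * Weak compactness and the bidual *)

Section Duality.
Context (R : realType).

Lemma dual_scaler (V : normedModType R) (f : dual V) (a : R) x :
  f (a *: x) = a * f x.
Proof. exact: linearZ. Qed.

Lemma dual_sumE (V : normedModType R) (I : Type) (r : seq I) (f : I -> dual V)
    x :
  (\sum_(i <- r) f i) x = \sum_(i <- r) f i x.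
Proof.
elim: r => [|i r IHr]; first by rewrite !big_nil dual0E.
by rewrite !big_cons dualDE IHr.
Qed.

Section evaluation.
Context (V : normedModType R).

Fact dual_eval_linear (x : V) : linear (fun f : dual V => f x : R^o).
Proof. by []. Qed.

Fact dual_eval_bound (x : V) (f : dual V) : `|f x : R^o| <= `|x| * `|f|.
Proof. by rewrite mulrC ler_dual_norm. Qed.

Definition dual_eval (x : V) : dual (dual V) :=
  mk_linear_continuous (dual_eval_linear x)
    (linear_bound_continuous (dual_eval_linear x) (dual_eval_bound x)).

Lemma weak_nbhs (f : dual V) (x : V) (e : R) : 0 < e ->
  nbhs (x : weak V) [set z : weak V | `|f x - f z| < e].
Proof.
move=> e0; have /weak_cvgP/(_ f) : nbhs (x : weak V) --> (x : weak V) by [].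
by move=> /cvgrPdist_lt/(_ _ e0).
Qed.

End evaluation.

Lemma hausdorff_weak_dual (V : normedModType R) :
  hausdorff_space (weak (dual V)).
Proof.
move=> p q pq; apply: linear_continuous_eqP => x.
apply/eqP; rewrite -subr_eq0 -normr_le0.
apply/ler_addgt0Pl => e e0; rewrite addr0.
have e2 : 0 < e / 2 by rewrite divr_gt0.
have [z [pz qz]] := pq _ _ (weak_nbhs (dual_eval x) p e2)
  (weak_nbhs (dual_eval x) q e2).
have {}pz : `|p x - z x| < e / 2 := pz.
have {}qz : `|z x - q x| < e / 2 by rewrite distrC.
rewrite -[_ - _](subrKA (z x)) (le_trans (ler_normD _ _))//.
by lra.
Qed.

Lemma ultra_bounded_cvg (T : Type) (U : set_system T) (f : T -> R) (M : R) :
  UltraFilter U -> U [set t | `|f t| <= M] -> cvg (f @ U).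
Proof.
move=> UU UM; have [|l [_ fl]] := @segment_compact R (- M) M (f @ U) _.
  by apply: (@filterS _ U _ _ _ _ UM) => t /=; rewrite in_itv/= ler_norml.
apply/cvg_ex; exists l => V lV.
have [//|UnV] := in_ultra_setVsetC (f @^-1` V) UU.
by have [r []] := fl (~` V) V UnV lV.
Qed.

(** Finite dimensional separation without a closest point: let [k] in [K] nearly
    minimize [sum_g (psi g - g k)^2]. Moving from [k] towards any other point of
    [K] cannot decrease this sum much, so the functional
    [sum_g (psi g - g k) g] is nearly maximal over [K] at [k], and the
    hypothesis applied to this functional bounds the sum itself. *)
Lemma convex_approximation (V : normedModType R) (K : set V)
    (psi : dual (dual V)) (M : R) :
  (forall x y (t : R), K x -> K y -> 0 <= t <= 1 -> K (x + t *: (y - x))) ->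
  (forall x, K x -> `|x| <= M) ->
  (forall (g : dual V) c, (forall x, K x -> g x <= c) -> psi g <= c) ->
  forall (gs : seq (dual V)) (e : R), 0 < e ->
  exists2 k, K k & \sum_(g <- gs) (psi g - g k) ^+ 2 < e.
Proof.
move=> cK bK Kpsi gs e e0; apply: contrapT => /forall2NP far.
pose D k := \sum_(g <- gs) (psi g - g k) ^+ 2.
have {}far k : K k -> e <= D k.
  by move=> Kk; have [//|/negP] := far k; rewrite -leNgt.
have [x0 Kx0] : K !=set0.
  apply/set0P/negP => /eqP K0; have := Kpsi 0 (-1); rewrite linear0.
  by rewrite K0 => /(_ (fun x => False_ind _)); rewrite lerNr oppr0 ler10.
pose B := \sum_(g <- gs) (`|g| * (2 * M)) ^+ 2.
have B0 : 0 <= B by apply: sumr_ge0 => g _; exact: sqr_ge0.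
(* A step [t] this short keeps the second order term below [t e]. *)
pose t := Num.min 1 (e / (1 + B)).
have t0 : 0 < t by rewrite lt_min ltr01 divr_gt0// ltr_wpDr.
have t1 : t <= 1 by rewrite ge_min lexx.
have te : t * (1 + B) <= e.
  by rewrite -ler_pdivlMr ?ltr_wpDr// ge_min lexx orbT.
have hD : has_inf [set D k | k in K].
  by split; [exists (D x0), x0|exists e => _ [k Kk <-]; exact: far].
have [_ [k Kk <-] Dk] := inf_adherent (exprn_gt0 2 t0) hD.
have D_ge k' : K k' -> inf [set D k | k in K] <= D k'.
  by move=> Kk'; apply: (ge_inf hD.2); exists k'.
pose g : dual V := \sum_(g <- gs) (psi g - g k) *: g.
have gE x : g x = \sum_(g <- gs) (psi g - g k) * g x.
  by rewrite dual_sumE.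
have g_le k' : K k' -> g k' <= g k + e / 2.
  move=> Kk'; have Kt : K (k + t *: (k' - k)) by apply: cK => //; rewrite ltW.
  have Dt : D (k + t *: (k' - k)) =
      D k - 2 * t * (g k' - g k) + t ^+ 2 * \sum_(g <- gs) (g (k' - k)) ^+ 2.
    rewrite !gE -sumrB !mulr_sumr -sumrB -big_split; apply: eq_bigr => h _ /=.
    by rewrite linearD linearZ/= linearB /= -[t *: _]/(t * _); ring.
  have DB : \sum_(g <- gs) (g (k' - k)) ^+ 2 <= B.
    apply: ler_sum => h _; rewrite -real_normK ?num_real// ler_sqr ?nnegrE//.
      rewrite (le_trans (ler_dual_norm _ _))// ler_wpM2l//.
      by rewrite (le_trans (ler_normB _ _))// mulr_natl mulr2n lerD ?bK.
    by rewrite mulr_ge0// mulr_ge0// (le_trans _ (bK _ Kk)).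
  have /(ler_wpM2l (sqr_ge0 t)) := DB; have := D_ge _ Kt; rewrite Dt => h1 h2.
  have : 2 * t * (g k' - g k) <= t * e.
    apply: (@le_trans _ _ (t * (t * (1 + B)))); last by rewrite ler_wpM2l// ltW.
    by lra.
  by rewrite mulrAC [t * e]mulrC ler_pM2r//; lra.
have := Kpsi g _ g_le; have : D k = psi g - g k.
  rewrite gE linear_sum/= -sumrB; apply: eq_bigr => h _.
  by rewrite linearZ/= -[_ *: _]/(_ * _) expr2 mulrBr.
by have := far _ Kk; lra.
Qed.

(** The sets of near solutions [k] in [K] of finitely many equations
    [g k = psi g] form a filter base; any weak cluster point solves all of
    them. *)
Lemma weakly_compact_represented (V : normedModType R) (K : set V)
    (psi : dual (dual V)) (M : R) :
  (forall x y (t : R), K x -> K y -> 0 <= t <= 1 -> K (x + t *: (y - x))) ->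
  (forall x, K x -> `|x| <= M) ->
  (forall (g : dual V) c, (forall x, K x -> g x <= c) -> psi g <= c) ->
  relatively_weakly_compact K -> exists y : V, forall g : dual V, psi g = g y.
Proof.
move=> cK bK Kpsi; rewrite /relatively_weakly_compact precompactE => cptK.
have hel := convex_approximation cK bK Kpsi.
pose D := [set p : seq (dual V) * R | 0 < p.2].
pose N p : set (weak V) :=
  [set k : V | K k /\ \sum_(g <- p.1) (psi g - g k) ^+ 2 < p.2].
have sq_ge0 (r : seq (dual V)) (k : V) : 0 <= \sum_(g <- r) (psi g - g k) ^+ 2.
  by apply: sumr_ge0 => g _; exact: sqr_ge0.
have FN : ProperFilter (filter_from D N).
  apply: filter_from_proper.
    apply: filter_from_filter; first by exists ([::], 1) => /=; exact: ltr01.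
    move=> [r a] [s b] /= a0 b0; exists (r ++ s, Num.min a b).
      by rewrite /D/= lt_min a0.
    move=> k [Kk]; rewrite big_cat/= lt_min => /andP[ka kb].
    by split; split => //=; have := sq_ge0 r k; have := sq_ge0 s k; lra.
  by move=> [r a] a0; have [k Kk ka] := hel r a a0; exists k.
have [|y [_ yN]] := cptK _ FN.
  by exists ([::], 1) => [|k [Kk _]]; [exact: ltr01|exact: subset_closure].
exists y => g; apply/eqP; rewrite -subr_eq0 -normr_le0.
apply/ler_addgt0Pl => e e0; rewrite addr0.
have e2 : 0 < e / 2 by rewrite divr_gt0.
have Ng : filter_from D N (N ([:: g], (e / 2) ^+ 2)).
  by exists ([:: g], (e / 2) ^+ 2) => //; rewrite /D/= exprn_gt0.
have [k [[_ +] yk]] := yN _ _ Ng (weak_nbhs g y e2).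
rewrite /= big_seq1 -real_normK ?num_real// ltr_sqr ?nnegrE ?(ltW e2)// => gk.
have {}yk : `|g y - g k| < e / 2 := yk.
rewrite -[_ - _](subrKA (g k)) (le_trans (ler_normD _ _))//.
by rewrite distrC in yk; lra.
Qed.

(** The half of Gantmacher's theorem that passes from the bidual to the adjoint.
    An ultrafilter on the image of a ball is lifted to the ball, where it
    converges pointwise; the hypothesis turns pointwise convergence into weak
    convergence of the images. *)
Lemma bidual_represented_rel_compact (V W : normedModType R)
    (T : {linear_continuous V -> W}) (A : set (dual W)) (M : R) :
  (forall phi : dual (dual V), exists y, forall g, phi (adjoint T g) = g y) ->
  (forall g, A g -> `|g| <= M) -> relatively_weakly_compact (adjoint T @` A).
Proof.
move=> rep bA; pose K : set (weak (dual V)) := adjoint T @` [set g | `|g| <= M].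
suff cK : compact K.
  exists K; last first.
    by split => //; apply: compact_closed => //; exact: hausdorff_weak_dual.
  by move=> _ [g Ag <-]; exists g => //; exact: bA.
rewrite compact_ultra => U UU UK.
have /choice[s sK] (h : dual V) : exists g : dual W, K h ->
    `|g| <= M /\ adjoint T g = h.
  have [[g gM <-]|nKh] := pselect (K h); first by exists g.
  by exists 0 => /nKh.
have [h0 Kh0] := filter_ex UK.
have M0 : 0 <= M by rewrite (le_trans _ (sK _ Kh0).1).
have cs y : cvg ((fun h : weak (dual V) => s h y : R^o) @ U).
  apply: (@ultra_bounded_cvg _ U _ (M * `|y|)) => //.
  apply: filterS UK => h /sK[sM _] /=.
  by rewrite (le_trans (ler_dual_norm _ _))// ler_wpM2r.
pose L y : R^o := lim ((fun h : weak (dual V) => s h y : R^o) @ U).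
have Llin : linear L.
  move=> a x y; rewrite /L; apply: cvg_lim => //.
  under eq_fun do rewrite linearP.
  exact: (cvgD (cvgZ (cvg_cst a) (cs x)) (cs y)).
have LM y : `|L y| <= M * `|y|.
  have /cvg_norm/(@closed_cvg _ _ U _ _ [set r | r <= M * `|y|]) := cs y.
  apply; first exact: closed_le.
  apply: filterS UK => h /sK[sM _] /=.
  by rewrite (le_trans (ler_dual_norm _ _))// ler_wpM2r.
pose l : dual W := mk_linear_continuous Llin (linear_bound_continuous Llin LM).
exists (adjoint T l); split; first by exists l => //=; exact: dual_norm_bound.
apply/weak_cvgP => phi; have [y phiE] := rep phi.
rewrite phiE; apply: cvg_trans (cs y); apply: near_eq_cvg.
apply: filterS UK => h /sK[_ {2}<-].
by rewrite phiE.
Qed.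

End Duality.

(** * Random signed sums *)

Section PositiveFunctionals.
Context (R : realType) (E : banachLatticeType R).
Implicit Types (e f g : dual E) (x y u : E).

Lemma dual_ge0 e x : 0 <=v e -> 0 <=v x -> 0 <= e x.
Proof. by move=> /dual_vleP e0 x0; have := e0 x x0. Qed.

Lemma dual_homo e x y : 0 <=v e -> x <=v y -> e x <= e y.
Proof.
by move=> e0; rewrite -vle_subr_ge0 => /(dual_ge0 e0); rewrite linearB subr_ge0.
Qed.

End PositiveFunctionals.

Section SignedSums.
Context (R : realType) (E : vectorLatticeType R).
Implicit Types (x y u : E) (ys : seq E).

Lemma vle_double x : (0 <=v x + x) = (0 <=v x).
Proof.
apply/idP/idP => [xx|x0]; last exact: vle_add0.
have -> : x = 2^-1 *: (x + x).
  by rewrite -mulr2n -(scaler_nat 2 x) scalerA mulVf ?scale1r// pnatr_eq0.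
by apply: vle_scale0 => //; rewrite invr_ge0 ler0n.
Qed.

Lemma vle_double2 x y : (x + x <=v y + y) = (x <=v y).
Proof. by rewrite -vle_subr_ge0 opprD addrACA vle_double vle_subr_ge0. Qed.

Lemma vabs_add_le x y u : (vabs x + vabs y <=v u) =
  [&& x + y <=v u, x - y <=v u, - x + y <=v u & - x - y <=v u].
Proof.
have le_subr a b : (a <=v u - b) = (a + b <=v u).
  by rewrite -[b in RHS]opprK vle_subl_add.
rewrite -le_subr vabs_le !le_subr ![_ + vabs y]addrC.
rewrite -!le_subr !vabs_le !le_subr.
by rewrite ![_ + x]addrC ![_ - x]addrC -!andbA.
Qed.

(** Both sides are the supremum of [2x], [-2x], [2y] and [-2y]. *)
Lemma vabs_parallelogram x y :
  vabs (x + vabs y) + vabs (x - vabs y) = vabs (x + y) + vabs (x - y).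
Proof.
have four z u : (vabs (x + z) + vabs (x - z) <=v u) =
    [&& x + x <=v u, z + z <=v u, - (z + z) <=v u & - (x + x) <=v u].
  rewrite vabs_add_le !opprD !opprK.
  congr [&& _ <=v u, _ <=v u, _ <=v u & _ <=v u].
  - by rewrite addrACA subrr addr0.
  - by rewrite addrACA subrr add0r.
  - by rewrite addrACA addNr add0r.
  - by rewrite addrACA addNr addr0.
have yy u : (vabs y + vabs y <=v u) && (- (vabs y + vabs y) <=v u) =
    (y + y <=v u) && (- (y + y) <=v u).
  apply/andP/andP => [[h _]|[h1 h2]].
    split; apply: vle_trans h; first by rewrite vle_double2 vle_abs.
    by rewrite opprD vle_double2 vle_absN.
  have u0 : 0 <=v u.
    by rewrite -vle_double -(subrr (y + y)) vle_add.
  have h : vabs y + vabs y <=v u.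
    by rewrite vabs_add_le h1 subrr addNr u0 -opprD h2.
  split => //; apply: vle_trans u0.
  by rewrite -oppr0 vle_opp// vle_double vabs_ge0.
have same u : (vabs (x + vabs y) + vabs (x - vabs y) <=v u) =
    (vabs (x + y) + vabs (x - y) <=v u).
  by rewrite !four; congr (_ && _); rewrite !andbA yy.
by apply: vle_anti; rewrite same vle_refl -same vle_refl.
Qed.

(** The sum of [vabs (x + e_1 y_1 + ... + e_n y_n)] over all signs [e_i]. *)
Fixpoint sum_signs ys x : E :=
  if ys is y :: ys' then sum_signs ys' (x + y) + sum_signs ys' (x - y)
  else vabs x.

Lemma sum_signs_swap ys x y :
  sum_signs ys (x + vabs y) + sum_signs ys (x - vabs y) =
  sum_signs ys (x + y) + sum_signs ys (x - y).
Proof.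
elim: ys x => [|z ys IHys] x /=; first exact: vabs_parallelogram.
by rewrite addrACA [RHS]addrACA !(addrAC x _ z) !(addrAC x _ (- z)) !IHys.
Qed.

Lemma sum_signs_vabs ys x : sum_signs (map (@vabs R E) ys) x = sum_signs ys x.
Proof.
elim: ys x => [//|y ys IHys] x /=.
by rewrite !IHys sum_signs_swap.
Qed.

(** Read [a = sin s], [b = cos s], [c = cos r], [d = sin r]. Each sign turns the
    angle [s] by [r] or [- r], and the last vector [v] of a path of signs
    satisfies [vabs v >= sin (final angle) v]. The sums over all paths close up
    under [sin (s + r) + sin (s - r) = 2 cos r sin s] and
    [sin (s + r) - sin (s - r) = 2 sin r cos s]. The predecessor in the exponent
    is harmless: its value for the empty sequence multiplies an empty sum. *)
Lemma sum_signs_ge (c d : R) : c ^+ 2 + d ^+ 2 = 1 ->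
  forall ys (a b : R) x, a ^+ 2 + b ^+ 2 = 1 ->
  ((2 * c) ^+ size ys * a) *: x +
    (2 * d * b * (2 * c) ^+ (size ys).-1) *: (\sum_(y <- ys) y)
  <=v sum_signs ys x.
Proof.
move=> cd; elim=> [|y ys IHys] a b x ab /=.
  rewrite big_nil scaler0 addr0 expr0 mul1r.
  have a1 : `|a| <= 1.
    rewrite -(@ler_pXn2r _ 2) ?nnegrE// expr1n real_normK ?num_real//.
    by have := sqr_ge0 b; lra.
  have [a0|a0] := leP 0 a.
    apply: (vle_trans (vle_scale a0 (vle_abs x))).
    rewrite -[vabs x in X in _ <=v X]scale1r vle_scaleW ?vabs_ge0//.
    by rewrite -(ger0_norm a0).
  rewrite -[a]opprK scaleNr -scalerN.
  have Na0 : 0 <= - a by rewrite oppr_ge0 ltW.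
  apply: (vle_trans (vle_scale Na0 (vle_absN x))).
  rewrite -[vabs x in X in _ <=v X]scale1r vle_scaleW ?vabs_ge0//.
  by rewrite -(ltr0_norm a0).
have rot (s : R) : s ^+ 2 = 1 ->
    (a * c + s * (b * d)) ^+ 2 + (b * c - s * (a * d)) ^+ 2 = 1.
  move=> s1; have -> : (a * c + s * (b * d)) ^+ 2 + (b * c - s * (a * d)) ^+ 2 =
    (a ^+ 2 + b ^+ 2) * c ^+ 2 + s ^+ 2 * ((a ^+ 2 + b ^+ 2) * d ^+ 2) by ring.
  by rewrite ab s1 !mul1r.
have hp := IHys _ _ (x + y) (rot 1 (expr1n _ _)).
have hm := IHys _ _ (x - y) (rot (-1) (etrans (sqrrN 1) (expr1n _ _))).
have {hp hm} := vle_add hp hm; congr (_ <=v _).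
set S := \sum_(_ <- _) _.
have comb (p q r s : R) : p *: (x + y) + q *: S + (r *: (x - y) + s *: S) =
    (p + r) *: x + ((p - r) *: y + (q + s) *: S).
  rewrite !scalerDr !scalerDl scalerN scaleNr addrACA [RHS]addrA; congr (_ + _).
  by rewrite addrACA.
rewrite comb big_cons -/S [in RHS]scalerDr; congr (_ *: _ + (_ *: _ + _)).
- by rewrite exprS; ring.
- by ring.
rewrite /S; case: ys {IHys comb S} => [|z ys] /=.
  by rewrite big_nil !scaler0.
by congr (_ *: _); rewrite exprS; ring.
Qed.

Lemma bernoulli_ge (s : R) n : 0 <= s <= 1 -> 1 - n%:R * s <= (1 - s) ^+ n.
Proof.
move=> /andP[s0 s1]; elim: n => [|n IHn]; first by rewrite mul0r subr0 expr0.
have n0 : 0 <= n%:R * (s * s) :> R by rewrite mulr_ge0// mulr_ge0.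
have s1' : 0 <= 1 - s by rewrite subr_ge0.
have := ler_wpM2l s1' IHn; rewrite exprS -natr1; lra.
Qed.

(** The angle [r] is given by [tan (r / 2) = 1 / (2 k)], so that its sine and
    cosine are rational. It is of the order [1 / k]; hence [cos r ^ (k ^ 2)]
    stays above [1/2] while [sin r] is at least [1 / (2 k)]. Replacing the
    vectors by their absolute values does not change [sum_signs], so the bound
    is in terms of these. *)
Lemma sum_signs_large ys (k : nat) : (0 < k)%N -> size ys = (k ^ 2)%N ->
  (2 ^+ size ys / (4 * k%:R)) *: (\sum_(y <- ys) vabs y) <=v sum_signs ys 0.
Proof.
move=> k0 sz; rewrite -sum_signs_vabs.
have k0R : (0 : R) < k%:R by rewrite ltr0n.
pose t : R := (2 * k%:R)^-1.
have t0 : 0 < t by rewrite invr_gt0 mulr_gt0.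
have tk : 4 * k%:R ^+ 2 * t ^+ 2 = 1.
  by rewrite /t; field; rewrite gt_eqF.
have k1R : (1 : R) <= k%:R ^+ 2 by rewrite -natrX ler1n expn_gt0 k0.
have t2 : 4 * t ^+ 2 <= 1.
  by rewrite -[leRHS]tk mulrAC ler_peMr// mulr_ge0// sqr_ge0.
have t2_ge0 := sqr_ge0 t.
have t12 : 0 < 1 + t ^+ 2 by lra.
pose c := (1 - t ^+ 2) / (1 + t ^+ 2); pose d := 2 * t / (1 + t ^+ 2).
have cd : c ^+ 2 + d ^+ 2 = 1.
  by rewrite /c /d; field; rewrite gt_eqF.
have ct : 1 - 2 * t ^+ 2 <= c by rewrite /c ler_pdivlMr//; nra.
have dt : t <= d by rewrite /d ler_pdivlMr//; nra.
have cn : 2^-1 <= c ^+ (size ys).-1.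
  have c1 : 0 <= 1 - 2 * t ^+ 2 by lra.
  apply: (@le_trans _ _ ((1 - 2 * t ^+ 2) ^+ (size ys).-1)); last first.
    by rewrite lerXn2r// nnegrE// (le_trans c1).
  apply: le_trans (bernoulli_ge _ _); last by rewrite mulr_ge0//=; lra.
  have : (size ys).-1%:R <= k%:R ^+ 2 :> R.
    by rewrite -natrX ler_nat sz leq_pred.
  by move=> /(ler_wpM2r t2_ge0); lra.
have ab : (0 : R) ^+ 2 + 1 ^+ 2 = 1 by rewrite expr0n expr1n add0r.
have := sum_signs_ge cd (map (@vabs R E) ys) 0 ab.
rewrite scaler0 add0r size_map big_map; apply: vle_trans.
apply: vle_scaleW; last first.
  elim/big_rec: _ => [|y z _ z0]; first exact: vle_refl.
  by apply: vle_add0 => //; exact: vabs_ge0.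
have n0 : (0 < size ys)%N by rewrite sz expn_gt0 k0.
have -> : 2 * d * 1 * (2 * c) ^+ (size ys).-1 =
    2 ^+ size ys * (d * c ^+ (size ys).-1).
  by rewrite -{2}(prednK n0) exprS exprMn; ring.
rewrite ler_pM2l ?exprn_gt0//.
have -> : (4 * k%:R)^-1 = t * 2^-1 :> R.
  by rewrite /t; field; rewrite gt_eqF.
by apply: ler_pM => //; [exact: ltW|rewrite invr_ge0].
Qed.

End SignedSums.

Section UnconditionalSeries.
Context (R : realType) (E : banachLatticeType R).

Lemma sum_signs_le (e : dual E) (M : R) ys (x : E) : 0 <=v e -> 0 <= M ->
  (forall f : dual E, `|f x| + \sum_(y <- ys) `|f y| <= M * `|f|) ->
  e (sum_signs ys x) <= 2 ^+ size ys * (`|e| * M).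
Proof.
move=> e0 M0; elim: ys x => [|y ys IHys] x /= fM.
  rewrite expr0 mul1r (le_trans (ler_norm _))//.
  rewrite (le_trans (ler_dual_norm _ _))//.
  rewrite ler_wpM2l// norm_vabs; have [g g1 gx] := norming_functional x.
  have := fM g; rewrite gx normr_id big_nil addr0 => /le_trans; apply.
  by rewrite -[leRHS]mulr1 ler_wpM2l.
rewrite linearD exprS -mulrA mulr_natl mulr2n lerD// IHys// => f.
  apply: le_trans (fM f); rewrite big_cons addrA lerD2r linearD.
  exact: ler_normD.
apply: le_trans (fM f); rewrite big_cons addrA lerD2r linearB.
exact: ler_normB.
Qed.

(** The seminorm [x |-> e (vabs x)] is additive on the cone, so the average of
    the signed sums of [k ^ 2] vectors of size at least [delta] is at least
    [k delta / 4] in it, while the hypothesis bounds each of these sums. *)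
Lemma unconditional_small (e : dual E) (z : nat -> E) (M delta : R) : 0 <=v e ->
  0 <= M ->
  (forall (f : dual E) n, \sum_(0 <= i < n) `|f (z i)| <= M * `|f|) ->
  0 < delta ->
  exists n, e (vabs (z n)) < delta.
Proof.
move=> e0 M0 fM d0; apply: contrapT => /forallNP far.
have {}far n : delta <= e (vabs (z n)) by rewrite leNgt; exact/negP.
pose C := `|e| * M.
have bound (k : nat) : (0 < k)%N -> k%:R * delta <= 4 * C.
  move=> k0; have k0R : (0 : R) < k%:R by rewrite ltr0n.
  pose ys := map z (index_iota 0 (k ^ 2)).
  have sz : size ys = (k ^ 2)%N by rewrite size_map size_iota subn0.
  have low := sum_signs_large k0 sz.
  have up : e (sum_signs ys 0) <= 2 ^+ size ys * C.
    by apply: sum_signs_le => // f; rewrite linear0 normr0 add0r big_map.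
  have := dual_homo e0 low; rewrite linearZ/= => /le_trans/(_ up).
  rewrite -[_ *: _]/(_ * _) -mulrA ler_pM2l ?exprn_gt0//.
  rewrite mulrC ler_pdivrMr ?mulr_gt0//.
  rewrite linear_sum big_map => h.
  have : \sum_(i <- index_iota 0 (k ^ 2)) delta <= C * (4 * k%:R).
    by apply: le_trans h; apply: ler_sum => i _; exact: far.
  rewrite sumr_const_nat subn0 -[delta *+ _]mulr_natl natrX expr2 -mulrA.
  by rewrite (_ : C * (4 * k%:R) = k%:R * (4 * C)); [rewrite ler_pM2l|ring].
have := bound (Num.truncn (4 * C / delta)).+1 isT.
by rewrite leNgt -ltr_pdivrMr// truncnS_gt.
Qed.

End UnconditionalSeries.

(** * Order structure of the dual *)

Section DualLattice.
Context (R : realType) (E : banachLatticeType R).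
Implicit Types (e f g h : dual E) (x y u : E).

Lemma le_dual_vabs f x u : vabs x <=v u -> f x <= vabs f u.
Proof.
rewrite vabs_le => /andP[xu Nxu].
have p : 0 <=v u + x by rewrite -[x]opprK vle_subr_ge0.
have m : 0 <=v u - x by rewrite vle_subr_ge0.
have /dual_vleP/(_ _ p) := vle_abs f; have /dual_vleP/(_ _ m) := vle_absN f.
rewrite dualNE (linearB f) (linearB (vabs f)) (linearD f) (linearD (vabs f)).
by lra.
Qed.

Lemma normr_dual_le f x : `|f x| <= vabs f (vabs x).
Proof.
rewrite ler_norml lerNl -linearN !le_dual_vabs ?vle_refl//.
by rewrite vabsN vle_refl.
Qed.

(** In the Riesz-Kantorovich formula for [vabs f u], the elements [u - 2 x] with
    [0 <= x <= u] run through the order interval [[-u, u]]. *)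
Lemma ge_dual_vabs f u c : 0 <=v u -> (forall x, vabs x <=v u -> f x <= c) ->
  vabs f u <= c.
Proof.
move=> u0 fc; rewrite -[vabs f]/(f + dual_pos (- f - f)) dualDE -lerBrDl.
rewrite dual_posE//; apply: ge_sup.
  by exists ((- f - f) 0), 0; rewrite //= vle_refl u0.
move=> _ [x [x0 xu] <-]; suff xu2 : vabs (u - (x + x)) <=v u.
  by have := fc _ xu2; rewrite (linearB f) (linearD f) dualBE dualNE; lra.
rewrite vabs_le opprB !vle_subl_add.
by rewrite -{1}[u]addr0 !vle_add ?vle_refl// vle_add0.
Qed.

Lemma normr_dual_pos e x : 0 <=v e -> `|e x| <= e (vabs x).
Proof. by move=> e0; have := normr_dual_le e x; rewrite ge0_vabs. Qed.

Lemma dual_norm_pos_bound e (M : R) : 0 <=v e -> 0 <= M ->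
  (forall u, 0 <=v u -> e u <= M * `|u|) -> `|e| <= M.
Proof.
move=> e0 M0 eM; apply: dual_norm_bound => // x.
by rewrite (le_trans (normr_dual_pos x e0))// -(norm_vabs x) eM// vabs_ge0.
Qed.

(** The Riesz-Kantorovich formula for the infimum of two functionals. *)
Lemma dual_vinf_approx f g x (eps : R) : 0 <=v x -> 0 < eps ->
  exists y, [/\ 0 <=v y, y <=v x & f (x - y) + g y <= vinf f g x + eps].
Proof.
move=> x0 eps0.
have S : has_sup [set (f - g) y | y in [set y | 0 <=v y /\ y <=v x]].
  split; first by exists ((f - g) 0), 0; rewrite //= vle_refl x0.
  exists (`|f - g| * `|x|) => _ [y [y0 yx] <-].
  rewrite (le_trans (ler_norm _))// (le_trans (ler_dual_norm _ _))//.
  by rewrite ler_wpM2l// le_norm_ge0.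
have [_ [y [y0 yx] <-] fgy] := sup_adherent eps0 S.
exists y; split => //; have -> : vinf f g = f - dual_pos (f - g).
  rewrite -[LHS]/(- (- f + dual_pos (- g - - f))).
  by rewrite opprD !opprK [- g + f]addrC.
by rewrite !dualBE dual_posE// linearB; move: fgy; rewrite dualBE; lra.
Qed.

Lemma dual_eval_ge0 u : 0 <=v u -> 0 <=v dual_eval u.
Proof. by move=> u0; apply/dual_vleP => f /dual_ge0; exact. Qed.

Lemma dual_eval_homo x y : x <=v y -> dual_eval x <=v dual_eval y.
Proof. by move=> xy; apply/dual_vleP => f f0; exact: (dual_homo f0 xy). Qed.

End DualLattice.

(** * Approximation in the bidual of a space whose dual is KB *)

Section KB.
Context (R : realType) (E : banachLatticeType R).
Hypothesis KB : KB_space (dual E).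
Variable phi : dual (dual E).
Hypothesis phi0 : 0 <=v phi.
Implicit Types (f g h z : dual E) (u w : E).

Let trunc w : dual (dual E) := vinf phi (dual_eval w).

Lemma vinf_eval_ge0 w : 0 <=v w -> 0 <=v vinf phi (dual_eval w).
Proof. by move=> w0; rewrite vle_inf phi0 dual_eval_ge0. Qed.

Lemma vinf_eval_homo u w : u <=v w ->
  vinf phi (dual_eval u) <=v vinf phi (dual_eval w).
Proof.
move=> uw; rewrite vle_inf vle_infl; apply: vle_trans (dual_eval_homo uw).
exact: vle_infr.
Qed.

(** The infimum over [w] of [phi - trunc w] is the part of [phi] disjoint from
    [E]; [small g c] bounds its value at [g], and such bounds add up because the
    [trunc w] are directed. *)
Let small g (c : R) := exists2 w, 0 <=v w & (phi - trunc w) g <= c.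

Let small_le w w' g : 0 <=v g -> w <=v w' ->
  (phi - trunc w') g <= (phi - trunc w) g.
Proof.
move=> g0 ww'; have /dual_vleP/(_ _ g0) := vinf_eval_homo ww'.
by rewrite !dualBE; lra.
Qed.

Let smallD g h c d : 0 <=v g -> 0 <=v h -> small g c -> small h d ->
  small (g + h) (c + d).
Proof.
move=> g0 h0 [w w0 wc] [w' w'0 w'd]; exists (w + w'); first exact: vle_add0.
rewrite linearD; apply: lerD.
  apply: le_trans wc; apply: small_le => //.
  by rewrite -[w in w <=v _]addr0 vle_add ?vle_refl.
apply: le_trans w'd; apply: small_le => //.
by rewrite -[w' in w' <=v _]add0r vle_add ?vle_refl.
Qed.

(** This is where disjointness from [u] enters: the infimum of [phi] and [n u]
    at [g] is nearly attained by a splitting of [g] into [g - h] and [h], and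
    [n h u <= phi g + eps] makes [h u] small for large [n]. *)
Let small_split g u (eps : R) : 0 <=v g -> 0 <=v u -> 0 < eps ->
  exists h, [/\ 0 <=v h, h <=v g, small (g - h) eps & h u <= eps].
Proof.
move=> g0 u0 eps0; pose n := (Num.truncn ((phi g + eps) / eps)).+1.
have w0 : 0 <=v n%:R *: u by rewrite vle_scale0.
have [h [h0 hg hn]] := dual_vinf_approx phi (dual_eval (n%:R *: u)) g0 eps0.
have gh0 : 0 <=v g - h by rewrite vle_subr_ge0.
have hnu : dual_eval (n%:R *: u) h = n%:R * h u by rewrite /= linearZ.
rewrite hnu in hn.
exists h; split => //.
  exists (n%:R *: u) => //; rewrite -/(trunc _) in hn; rewrite dualBE.
  have : trunc (n%:R *: u) g = trunc (n%:R *: u) (g - h) + trunc (n%:R *: u) h.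
    by rewrite -linearD subrK.
  have /dual_vleP/(_ _ h0) : trunc (n%:R *: u) <=v dual_eval (n%:R *: u).
    exact: vle_infr.
  by rewrite hnu; lra.
have : n%:R * h u <= phi g + eps.
  have /dual_vleP/(_ _ g0) : trunc (n%:R *: u) <=v phi by exact: vle_infl.
  by have := dual_ge0 phi0 gh0; rewrite -/(trunc _) in hn; lra.
have : (phi g + eps) / eps < n%:R by exact: truncnS_gt.
rewrite ltr_pdivrMr// => h1 h2; have n0 : (0 : R) < n%:R by rewrite ltr0n.
by rewrite -(ler_pM2l n0); lra.
Qed.

(** Start from [f] and remove, as long as possible, pieces that are large in
    norm but negligible for [small]. The process stops because decreasing
    positive sequences of a KB space are norm convergent. *)
Let small_stop f (eps : R) : 0 <=v f -> 0 < eps ->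
  exists z, exists2 eta, 0 < eta &
    [/\ 0 <=v z, z <=v f, small (f - z) eps &
        forall h, 0 <=v h -> h <=v z -> small (z - h) eta -> `|z - h| <= eps].
Proof.
move=> f0 eps0; apply: contrapT => nostop.
pose inv z c := [/\ 0 <=v z, z <=v f & small (f - z) c].
(* The mass removed up to step [n] is at most [eps (1 - 2^-n)]. *)
have /choice[next nextP] (p : dual E * nat) : exists z,
    inv p.1 (eps * (1 - 2^-1 ^+ p.2)) ->
    [/\ 0 <=v z, z <=v p.1, small (p.1 - z) (eps * 2^-1 ^+ p.2.+1) &
        eps < `|p.1 - z| ].
  case: p => [z n] /=.
  have [Iz|nIz] := pselect (inv z (eps * (1 - 2^-1 ^+ n))); last by exists 0.
  case: Iz => z0 zf [w w0 wz].
  apply: contrapT => noz; apply: nostop; exists z, (eps * 2^-1 ^+ n.+1).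
    by rewrite mulr_gt0 ?exprn_gt0 ?invr_gt0.
  split => //.
    exists w => //; apply: (le_trans wz).
    rewrite -[leRHS]mulr1 ler_wpM2l ?(ltW eps0)//.
    by rewrite gerBl exprn_ge0// invr_ge0.
  move=> h h0 hz hsm; rewrite leNgt; apply/negP => hbig.
  by apply: noz; exists h.
pose z := fix z n := if n is n'.+1 then next (z n', n') else f.
have zS n : z n.+1 = next (z n, n) by [].
have Iz n : inv (z n) (eps * (1 - 2^-1 ^+ n)).
  elim: n => [|n IHn].
    split; rewrite ?vle_refl//; exists 0; first exact: vle_refl.
    by rewrite subrr linear0 expr0 subrr mulr0.
  have [zn0 znf zsm] := IHn; have [z0 zz sm _] := nextP (z n, n) IHn.
  split; [by [] | by apply: vle_trans znf |].
  have -> : f - z n.+1 = (f - z n) + (z n - z n.+1) by rewrite subrKA.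
  have -> : eps * (1 - 2^-1 ^+ n.+1) =
      eps * (1 - 2^-1 ^+ n) + eps * 2^-1 ^+ n.+1.
    by rewrite exprS; field.
  by apply: smallD => //; rewrite vle_subr_ge0.
have zP n : [/\ 0 <=v z n.+1, z n.+1 <=v z n & eps < `|z n - z n.+1| ].
  by have [] := nextP (z n, n) (Iz n).
have : cvg ((fun n => f - z n) @ \oo).
  apply: KB => [n|m n mn|].
  - by have [_ zf _] := Iz n; rewrite vle_subr_ge0.
  - rewrite vle_sub ?vle_refl//; elim: n mn => [|n IHn].
      by rewrite leqn0 => /eqP ->; exact: vle_refl.
    rewrite leq_eqVlt => /predU1P[-> //|]; first exact: vle_refl.
    rewrite ltnS => /IHn; apply: vle_trans.
    by have [] := zP n.
  - exists `|f| => n; have [z0 zf _] := Iz n; apply: le_norm_ge0.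
      by rewrite vle_subr_ge0.
    by rewrite vle_subl_add -[f in f <=v _]addr0 vle_add ?vle_refl.
move=> /cvg_ex[l /cvgrPdist_lt] /(_ (eps / 2)); rewrite divr_gt0// => /(_ isT).
move=> [N _ lN]; have := lN N (leqnn N); have := lN N.+1 (leqnSn N) => /= l1 l2.
have [_ _] := zP N; apply/negP; rewrite -leNgt.
have -> : z N - z N.+1 = (f - z N.+1 - l) + (l - (f - z N)).
  by rewrite subrKA opprB [RHS]addrC subrKA.
rewrite (le_trans (ler_normD _ _))//; rewrite distrC in l1.
by lra.
Qed.

(** For the [z] at which the removal of pieces stops, splitting [z] against an
    arbitrary [u >= 0] gives [z u <= d `|u|]; so [`|z| <= d] and nothing is left
    of [f] but negligible pieces. *)
Lemma KB_vinf_eval_approx f (eps : R) : 0 <=v f -> 0 < eps ->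
  exists2 w, 0 <=v w & phi f - vinf phi (dual_eval w) f <= eps.
Proof.
move=> f0 eps0; pose d := eps / (1 + `|phi|).
have phi1 : 0 < 1 + `|phi| by rewrite ltr_wpDr.
have d0 : 0 < d by rewrite divr_gt0.
have [z [eta eta0 [z0 zf fz stop]]] := small_stop f0 d0.
have zd : `|z| <= d.
  apply: dual_norm_pos_bound => [//||u u0]; first exact: ltW.
  apply/ler_addgt0Pr => c c0.
  have m0 : 0 < Num.min c eta by rewrite lt_min c0.
  have [h [h0 hz [w w0 hsm] hu]] := small_split z0 u0 m0.
  have zh : `|z - h| <= d.
    apply: stop => //; exists w => //; apply: (le_trans hsm).
    by rewrite ge_min lexx orbT.
  rewrite -[z](subrK h) dualDE lerD//.
    rewrite (le_trans (ler_norm _))// (le_trans (ler_dual_norm _ _))//.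
    by rewrite ler_wpM2r.
  by rewrite (le_trans hu)// ge_min lexx.
have : small (f - z + z) (d + `|phi| * d).
  apply: smallD => //; first by rewrite vle_subr_ge0.
  exists 0; first exact: vle_refl.
  rewrite dualBE lerBlDr (le_trans (ler_norm _))//.
  rewrite (le_trans (ler_dual_norm _ _))//.
  apply: ler_wpDr; last by rewrite ler_wpM2l.
  by apply: dual_ge0 => //; exact/vinf_eval_ge0/vle_refl.
rewrite subrK => -[w w0 wf]; exists w => //; apply: (le_trans wf).
by rewrite /d -{1}[_ / _]mul1r -mulrDl mulrC mulfVK// gt_eqF.
Qed.

End KB.

(** * Representing the second adjoint *)

Section Representation.
Context (R : realType).

(** Norming functionals turn the uniform estimates on [psi] into a Cauchy
    condition on the approximating vectors. *)
Lemma represented_closed (F : completeNormedModType R) (psi : dual (dual F)) :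
  (forall eps : R, 0 < eps ->
    exists y : F, forall g : dual F, `|psi g - g y| <= eps * `|g|) ->
  exists y : F, forall g : dual F, psi g = g y.
Proof.
move=> app; have /choice[y yP] (n : nat) : exists y : F, forall g : dual F,
    `|psi g - g y| <= n.+1%:R^-1 * `|g|.
  by apply: app; rewrite invr_gt0.
have ydist m n : `|y m - y n| <= m.+1%:R^-1 + n.+1%:R^-1.
  have [g g1 <-] := norming_functional (y m - y n).
  rewrite linearB -[_ - _](subrKA (psi g)) (le_trans (ler_norm _))//.
  rewrite (le_trans (ler_normD _ _))// distrC.
  by apply: lerD; [apply: le_trans (yP m g) _|apply: le_trans (yP n g) _];
    rewrite -[leRHS]mulr1 ler_wpM2l// invr_ge0.
have small_inv (e : R) : 0 < e ->
    exists N, forall n, (N <= n)%N -> n.+1%:R^-1 <= e.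
  move=> e0; exists (Num.truncn e^-1) => n Nn.
  rewrite -[e]invrK lef_pV2 ?posrE ?invr_gt0// ltW//.
  by rewrite (lt_le_trans (truncnS_gt _))// ler_nat.
have : cvg (y @ \oo).
  apply: cauchy_cvg; apply: cauchy_exP => e e0.
  have e3 : 0 < e / 3 by rewrite divr_gt0.
  have [N NP] := small_inv _ e3.
  exists (y N); exists N => // n /= Nn; rewrite -ball_normE /=.
  have := ydist N n; have := NP _ (leqnn N); have := NP _ Nn.
  by move: (N.+1%:R^-1) (n.+1%:R^-1) => a b; lra.
move=> /cvg_ex[l yl]; exists l => g; apply/eqP.
rewrite -subr_eq0 -normr_le0; apply/ler_addgt0Pl => e e0; rewrite addr0.
have g1 : 0 < 1 + `|g| + `|g| by rewrite -addrA ltr_wpDr// addr_ge0.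
pose d := e / (1 + `|g| + `|g|).
have d0 : 0 < d by rewrite divr_gt0.
have [N NP] := small_inv _ d0.
move/cvgrPdist_le : yl => /(_ _ d0)[N' _ N'P].
pose n := maxn N N'.
have h1 := NP n (leq_maxl _ _); have h2 := N'P n (leq_maxr _ _).
rewrite -[_ - _](subrKA (g (y n))) (le_trans (ler_normD _ _))//.
have -> : e = d * (1 + `|g| + `|g|) by rewrite mulfVK// gt_eqF.
have h3 : `|psi g - g (y n)| <= d * `|g|.
  by rewrite (le_trans (yP n g))// ler_wpM2r.
have h4 : `|g (y n) - g l| <= d * `|g|.
  rewrite -linearB (le_trans (ler_dual_norm _ _))// mulrC ler_wpM2r//.
  by rewrite distrC.
by lra.
Qed.

Context (E F : banachLatticeType R) (T : {linear_continuous E -> F}).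

Section order_weakly_compact.
Hypothesis hT : almost_order_weakly_compact T.

Lemma order_bounded_represented (phi : dual (dual E)) (u : E) : 0 <=v u ->
  (forall f, phi f <= vabs f u) ->
  exists y : F, forall g, phi (adjoint T g) = g y.
Proof.
move=> u0 phiu; have [M TM] := linear_continuous_bound T.
pose K := T @` order_interval (- u) u.
have cK : relatively_weakly_compact K.
  apply: hT => eps eps0; exists u => // x ux; exists x => //; exists 0.
    by rewrite /= normr0.
  by rewrite scaler0 addr0.
apply: (@weakly_compact_represented _ _ K (adjoint (adjoint T) phi)
  (`|M| * `|u|)) => //.
- move=> _ _ t [x xu <-] [y yu <-] /andP[t0 t1].
  exists (x + t *: (y - x)); last first.
    by rewrite linearD linearZ linearB.
  move: xu yu => [ux xu] [uy yu].
  have -> : x + t *: (y - x) = (1 - t) *: x + t *: y.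
    by rewrite scalerBr scalerBl scale1r addrCA addrC addrAC.
  have t10 : 0 <= 1 - t by rewrite subr_ge0.
  have cv (z : E) : z = (1 - t) *: z + t *: z.
    by rewrite -scalerDl subrK scale1r.
  by split; [rewrite [- u]cv|rewrite [u in _ <=v u]cv];
    apply: vle_add; apply: vle_scale.
- move=> _ [x /order_intervalP xu <-]; rewrite (le_trans (TM x))//.
  rewrite (le_trans (ler_wpM2r _ (ler_norm M)))// ler_wpM2l//.
  exact: le_norm_of_vabs.
- move=> g c gc; rewrite /= (le_trans (phiu _))//.
  apply: ge_dual_vabs => // x xu.
  by apply: gc; exists x => //; exact/order_intervalP.
Qed.

Lemma order_unit_represented (phi : dual (dual E)) :
  (exists e : E, order_unit e) ->
  exists y : F, forall g, phi (adjoint T g) = g y.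
Proof.
move=> [e eU]; have [C C0 eC] := order_unit_bound eU; have [e0 _ _] := eU.
apply: (@order_bounded_represented phi (`|phi| *: (C *: e))).
  by rewrite !vle_scale0.
move=> f; rewrite (le_trans (ler_norm _))// (le_trans (ler_dual_norm _ _))//.
rewrite dual_scaler ler_wpM2l//.
have f0 : 0 <= vabs f (C *: e) by rewrite dual_ge0 ?vabs_ge0 ?vle_scale0.
apply: dual_norm_bound => // x; rewrite (le_trans (normr_dual_le _ _))//.
have := dual_homo (vabs_ge0 f) (eC x).
by rewrite [C * _]mulrC -scalerA dual_scaler mulrC.
Qed.

Section KB_dual.
Hypothesis KB : KB_space (dual E).
Hypothesis eF : exists e : dual F, order_unit e.
Variable phi : dual (dual E).
Hypothesis phi0 : 0 <=v phi.

Let trunc w : dual (dual E) := vinf phi (dual_eval w).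

Let trunc_represented w : 0 <=v w ->
  exists y : F, forall g, trunc w (adjoint T g) = g y.
Proof.
move=> w0; apply: (@order_bounded_represented _ w) => // f.
apply: le_trans (le_dual_vabs _ (vle_refl (vabs f))) _.
rewrite ge0_vabs; last exact: vinf_eval_ge0.
by have /dual_vleP/(_ _ (vabs_ge0 f)) := vle_infr phi (dual_eval w).
Qed.

(** Along a sequence [w n] that violates the Cauchy condition, the increments of
    [phi /\ w n] are positive and sum to at most [phi], so their images under
    [T''] form an unconditionally bounded series in [F]; and an order unit of
    [F'] bounds their terms below in the seminorm [x |-> e (vabs x)]. *)
Lemma vinf_eval_cauchy (eps : R) : 0 < eps -> exists2 w, 0 <=v w &
  forall w', w <=v w' -> forall g,
    `|vinf phi (dual_eval w') (adjoint T g) -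
      vinf phi (dual_eval w) (adjoint T g)| <= eps * `|g|.
Proof.
move=> eps0; apply: contrapT => /forall2NP nocauchy.
have /choice[next nextP] (w : E) : exists w', 0 <=v w -> w <=v w' /\
    exists g, eps * `|g| < `|trunc w' (adjoint T g) - trunc w (adjoint T g)|.
  have [w0|] := boolP (0 <=v w); last by exists 0.
  have [//|/existsNP[w' /not_implyP[ww' /existsNP[g gw]]]] := nocauchy w.
  by exists w'; split => //; exists g; rewrite ltNge; exact/negP.
pose w n := iter n next 0.
have w0 n : 0 <=v w n.
  elim: n => [|n wn]; first exact: vle_refl.
  by apply: (vle_trans wn); have [] := nextP _ wn.
have wS n : w n <=v w n.+1 by have [] := nextP _ (w0 n).
have /choice[y yP] n := trunc_represented (w0 n).
pose z n := y n.+1 - y n.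
have zE (g : dual F) n :
    g (z n) = trunc (w n.+1) (adjoint T g) - trunc (w n) (adjoint T g).
  by rewrite !yP linearB.
have [e eU] := eF; have [C C0 eC] := order_unit_bound eU; have [e0 _ _] := eU.
have [M TM] := linear_continuous_bound (adjoint T).
have [||||n zn] := @unconditional_small R F e z (`|phi| * `|M|) (eps / (C + 1)).
- exact: e0.
- by rewrite mulr_ge0.
- move=> f n; pose h := vabs (adjoint T f).
  apply: (@le_trans _ _ (\sum_(0 <= i < n) (trunc (w i.+1) h - trunc (w i) h))).
    apply: ler_sum => i _; rewrite zE -dualBE normr_dual_pos// vle_subr_ge0.
    exact/vinf_eval_homo.
  rewrite telescope_sumr// (le_trans (y := phi h))//.
    have t0 : 0 <= trunc (w 0%N) h by rewrite dual_ge0 ?vinf_eval_ge0 ?vabs_ge0.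
    have /dual_vleP/(_ _ (vabs_ge0 (adjoint T f))) : trunc (w n) <=v phi.
      exact: vle_infl.
    by rewrite -/h; lra.
  rewrite (le_trans (ler_norm _))// (le_trans (ler_dual_norm _ _))//.
  rewrite -mulrA ler_wpM2l// norm_vabs (le_trans (TM f))//.
  by rewrite ler_wpM2r// ler_norm.
- by rewrite divr_gt0// ltr_wpDl.
have [_ [g]] := nextP _ (w0 n); apply/negP; rewrite -leNgt.
rewrite -[next (w n)]/(w n.+1) -zE (le_trans (normr_dual_le _ _))//.
have /dual_vleP/(_ _ (vabs_ge0 (z n))) := eC g => /le_trans; apply.
rewrite dualZE mulrAC ler_wpM2r//.
have ez : 0 <= e (vabs (z n)) by rewrite dual_ge0 ?vabs_ge0.
by move: zn; rewrite ltr_pdivlMr ?ltr_wpDl// => zn; lra.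
Qed.

Lemma KB_represented_pos : exists y : F, forall g, phi (adjoint T g) = g y.
Proof.
apply: (@represented_closed F (adjoint (adjoint T) phi)) => eps eps0.
have [w w0 wP] := vinf_eval_cauchy eps0.
have [y yP] := trunc_represented w0.
exists y => g; rewrite -yP; apply/ler_addgt0Pr => c c0.
have c2 : 0 < c / 2 by rewrite divr_gt0.
pose f := adjoint T g.
have [w1 w10 h1] := KB_vinf_eval_approx KB phi0 (vpos_ge0 f) c2.
have [w2 w20 h2] := KB_vinf_eval_approx KB phi0 (vneg_ge0 f) c2.
pose w' := w + w1 + w2.
have ww' : w <=v w'.
  by rewrite -[w in w <=v _]addr0 /w' -addrA vle_add ?vle_refl ?vle_add0.
have w1w' : w1 <=v w'.
  rewrite -[w1 in w1 <=v _]add0r -[_ + _ in X in X <=v _]addr0 /w'.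
  by rewrite !vle_add ?vle_refl.
have w2w' : w2 <=v w'.
  by rewrite -[w2 in w2 <=v _]add0r /w' vle_add ?vle_refl// vle_add0.
have /dual_vleP/(_ _ (vpos_ge0 f)) := vinf_eval_homo phi w1w'.
have /dual_vleP/(_ _ (vneg_ge0 f)) := vinf_eval_homo phi w2w'.
have /dual_vleP/(_ _ (vpos_ge0 f)) := vle_infl phi (dual_eval w').
have /dual_vleP/(_ _ (vneg_ge0 f)) := vle_infl phi (dual_eval w').
have := wP _ ww' g; rewrite -/f => h3 h4 h5 h6 h7.
have fE (chi : dual (dual E)) : chi f = chi (vpos f) - chi (vneg f).
  by rewrite -{1}(vposBneg f) linearB.
rewrite -[adjoint (adjoint T) phi g]/(phi f).
rewrite -[_ - _](subrKA (trunc w' f)) (le_trans (ler_normD _ _))//.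
rewrite addrC lerD//; rewrite (fE phi) (fE (trunc w')) ler_norml.
rewrite /trunc; apply/andP; split; lra.
Qed.

End KB_dual.

End order_weakly_compact.

End Representation.

Lemma almost_order_bounded_norm (R : realType) (E : banachLatticeType R)
    (A : set E) :
  almost_order_bounded A -> exists M : R, forall x, A x -> `|x| <= M.
Proof.
move=> /(_ _ ltr01)[u u0 Au]; exists (`|u| + 1).
move=> x /Au[y /order_intervalP yu [b b1 <-]].
rewrite scale1r (le_trans (ler_normD _ _))// lerD//.
exact: le_norm_of_vabs.
Qed.

Theorem theorem2 (R : realType) (E F : banachLatticeType R)
    (T : {linear_continuous E -> F})
    (hT : almost_order_weakly_compact T)
    (hEF : (exists e : E, order_unit e) \/
           (KB_space (dual E) /\ exists e : dual F, order_unit e)) :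
  almost_order_weakly_compact (adjoint T).
Proof.
move=> A /almost_order_bounded_norm[M AM].
apply: (bidual_represented_rel_compact (M := M)) => // phi.
case: hEF => [eE|[KB eF]]; first exact: order_unit_represented.
have [y yP] := KB_represented_pos hT KB eF (vpos_ge0 phi).
have [y' y'P] := KB_represented_pos hT KB eF (vneg_ge0 phi).
exists (y - y') => g; rewrite -{1}(vposBneg phi) dualBE yP y'P.
by rewrite linearB.
Qed.
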